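(* Let $(W,S)$ be a Coxeter system with $S=\{s_i\}_{i\in I}$ (not necessarily finite) and Coxeter matrix $(m_{ij})_{i,j\in I}$. Let $i,j,k\in I$, and let $x_1\in [s_i]\hat R_{W,S}[s_j]$ and $x_2\in [s_j]\hat R_{W,S}[s_k]$ be elements of $\hat R_{W,S}$ such that $x_1x_2=0$. Then either $x_1=0$ or $x_2=0$.
   Context: A Coxeter matrix is $(m_{ij})_{i,j\in I}$ with $m_{ii}=1$ and $m_{ij}=m_{ji}\in\{2,3,\dots\}\cup\{\infty\}$ for $i\neq j$; the Coxeter system $(W,S)$ has $W=\langle s_i\ (i\in I)\mid (s_ks_l)^{m_{kl}}=1 \text{ whenever } m_{kl}\neq\infty\rangle$. The graph $\Gamma_{W,S}$ has vertex set $S$ and one directed edge $y_{ij}=[s_is_j]$ (origin $s_i$, terminus $s_j$) for each ordered pair $i\ne j$ with $m_{ij}\geq 3$ (including $m_{ij}=\infty$); write $\bar y_{ij}=y_{ji}$. Paths of length $n\ge1$ are sequences of edges $y_1\cdots y_n$ with the terminus of each edge equal to the origin of the next; a path is also written by its successive vertices as $[s_{i_0}s_{i_1}\cdots s_{i_n}]$. Paths of length $0$ are the vertices $[s]$, $s\in S$. The path algebra $\hat P_{W,S}=\mathbb{Q}\Gamma_{W,S}$ is the $\mathbb{Q}$-vector space with basis all paths, with multiplication given by concatenation when the terminus of the first path equals the origin of the second, and $0$ otherwise. For an integer $m\geq 3$ let $C_m(t)\in\mathbb{Z}[t]$ be the (monic) minimal polynomial of $4\cos^2(\pi/m)$ over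 $\mathbb{Q}$. For each edge $y_{ij}$ with $3\le m_{ij}<\infty$ put $C_{y_{ij}}=C_{m_{ij}}(y_{ij}\bar y_{ij})=C_{m_{ij}}([s_is_js_i])$, evaluated in the ring $[s_i]\hat P_{W,S}[s_i]$ with identity $[s_i]$. Let $\hat I_{W,S}$ be the two-sided ideal of $\hat P_{W,S}$ generated by all $C_{y_{ij}}$ with $3\le m_{ij}<\infty$, and $\hat R_{W,S}=\hat P_{W,S}/\hat I_{W,S}$ (unital iff $S$ is finite). The image of $[s]$ in $\hat R_{W,S}$ is still denoted $[s]$. *)

(* Defs.v *)
From HB Require Import structures.
From mathcomp Require Import all_boot all_order all_algebra.
From mathcomp Require Import boolp classical_sets.
From mathcomp Require Import finmap monalg.
From Stdlib Require Import Rtrigo_def Rtrigo1.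
From mathcomp Require Import Rstruct.
Set Implicit Arguments.
Unset Strict Implicit.
Unset Printing Implicit Defensive.
Import Order.TTheory GRing.Theory Num.Theory.
Local Open Scope ring_scope.

Definition is_min_poly (F : numFieldType) (x : F) (p : {poly rat}) : Prop :=
  [/\ p \is monic, root (map_poly ratr p) x
    & forall q : {poly rat}, q != 0 -> root (map_poly ratr q) x ->
        (size p <= size q)%N].

(* The minimal polynomial over Q of the real number 4 cos^2(PI / m); [xget]
   returns it, and not its default 0, by [coxCP] below. *)
Definition coxC (m : nat) : {poly rat} :=
  xget 0 [set p | is_min_poly (4%:R * cos (PI / m%:R) ^+ 2) p]%classic.

(* Two consecutive Chebyshev polynomials; they show that cos (PI / m) is
   algebraic. *)
Fixpoint cheb2 (n : nat) : {poly rat} * {poly rat} :=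
  if n is n'.+1 then
    let: (a, b) := cheb2 n' in (b, 'X * b *+ 2 - a)
  else (1, 'X).

Lemma cheb2_cos (n : nat) (t : Rdefinitions.R) :
  (map_poly ratr (cheb2 n).1).[cos t] = cos (n%:R * t) /\
  (map_poly ratr (cheb2 n).2).[cos t] = cos (n.+1%:R * t).
Proof.
elim: n => [|n].
  by rewrite /= rmorph1 map_polyX; split; rewrite ?hornerE ?mul1r ?mul0r ?cos_0.
rewrite /=; case: (cheb2 n) => a b /= [ha hb]; split => //.
rewrite rmorphB rmorphMn rmorphM /= map_polyX hornerD hornerN hornerMn hornerM.
rewrite hornerX ha hb.
have -> : n.+2%:R * t = n.+1%:R * t + t by rewrite -[n.+2]addn1 natrD mulrDl mul1r.
have -> : n%:R * t = n.+1%:R * t - t.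
  by rewrite -[n.+1]addn1 natrD mulrDl mul1r addrK.
have cosD (u v : Rdefinitions.R) : cos (u + v) = cos u * cos v - sin u * sin v.
  exact: cos_plus.
have cosB (u v : Rdefinitions.R) : cos (u - v) = cos u * cos v + sin u * sin v.
  exact: cos_minus.
by rewrite cosB cosD mulr2n opprD addrA [cos t * _]mulrC addrK.
Qed.

Lemma coxC_algebraic (m : nat) : (0 < m)%N ->
  algebraicOver (ratr : rat -> Rdefinitions.R) (4%:R * cos (PI / m%:R) ^+ 2).
Proof.
move=> m0.
have h : algebraicOver (ratr : rat -> Rdefinitions.R) (cos (PI / m%:R)).
  exists ((cheb2 m).1 + 1).
    apply/eqP => /(congr1 (fun p => (map_poly (ratr : rat -> Rdefinitions.R) p).[cos 0])).
    rewrite rmorphD rmorph1 rmorph0 hornerD (cheb2_cos _ _).1 mulr0 cos_0 !hornerE.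
    by apply/eqP; rewrite gt_eqF // addr_gt0.
  apply/rootP; rewrite rmorphD rmorph1 hornerD (cheb2_cos _ _).1.
  rewrite [m%:R * _]mulrC divfK ?pnatr_eq0 -?lt0n //.
  by rewrite cos_PI hornerE addNr.
by apply: algebraic_mul; [rewrite -(ratr_nat _ 4); apply: algebraic_id | apply: algebraic_mul].
Qed.

Lemma coxCP (m : nat) : (0 < m)%N ->
  is_min_poly (4%:R * cos (PI / m%:R) ^+ 2) (coxC m).
Proof.
move=> m0; rewrite /coxC; case: xgetP => [p _ hp //|none]; exfalso.
set x := 4%:R * _ in none.
have [p0 p0N0 rp0] := coxC_algebraic m0.
pose A n := `[< exists p : {poly rat},
  [/\ p != 0, root (map_poly ratr p) x & size p = n] >].
have exA : exists n, A n by exists (size p0); apply/asboolP; exists p0.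
case: (ex_minnP exA) => n /asboolP[p [pN0 rp <-]] minp.
apply: (none ((lead_coef p)^-1 *: p)); split.
- by rewrite monicE lead_coefZ mulVf // lead_coef_eq0.
- by rewrite map_polyZ rootE hornerZ (rootP rp) mulr0.
- move=> q qN0 rq; rewrite size_scale ?invr_eq0 ?lead_coef_eq0 //.
  by apply: minp; apply/asboolP; exists q.
Qed.

(* [None] stands for infinity.  The index set [I] is also the set of simple
   reflections: the group itself plays no role in the algebra below. *)
Record coxeter_matrix (I : Type) := CoxeterMatrix {
  cox_m :> I -> I -> option nat;
  cox_diag : forall i, cox_m i i = Some 1%N;
  cox_sym : forall i j, cox_m i j = cox_m j i;
  cox_offdiag : forall i j, i <> j ->
    if cox_m i j is Some n then (2 <= n)%N else true }.

(* Everything is defined over a field F and for a family of polynomials C_m;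
   the case of interest is F = rat and C = [coxC]. *)
Section PathAlgebra.
Variables (F : fieldType) (C : nat -> {poly F}).
Variables (I : choiceType) (M : coxeter_matrix I).

Definition cox_edge : rel I :=
  [rel i j | (i != j) && (if M i j is Some n then (3 <= n)%N else true)].

(* The walk [s_i0 s_i1 ... s_in] is the pair of i0 and [:: i1; ...; in]. *)
Definition cox_path : choiceType :=
  [the choiceType of {p : I * seq I | path cox_edge p.1 p.2}].

Local Notation path_alg := {malg F[cox_path]}.

(* Junk value 0 when the vertices do not form a path. *)
Definition walk (i : I) (s : seq I) : path_alg :=
  if insub (i, s) is Some p then << (p : cox_path) >> else 0.

Definition pa_cat (p q : cox_path) : path_alg :=
  if last (val p).1 (val p).2 == (val q).1
  then walk (val p).1 ((val p).2 ++ (val q).2) else 0.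

(* Non-unital when I is infinite, so no ring structure is declared. *)
Definition pa_mul (f g : path_alg) : path_alg :=
  \sum_(p <- msupp f) \sum_(q <- msupp g) (f@_p * g@_q) *: pa_cat p q.

(* Evaluation in the ring [s_i] P [s_i], whose identity is [s_i]. *)
Definition loop_eval (i : I) (p : {poly F}) (z : path_alg) : path_alg :=
  \sum_(n < size p) p`_n *: iter n (pa_mul z) (walk i [::]).

(* C_m(y_ij y_ji) *)
Definition cox_rel (i j : I) (m : nat) : path_alg :=
  loop_eval i (C m) (pa_mul (walk i [:: j]) (walk j [:: i])).

Record two_sided_ideal (J : path_alg -> Prop) : Prop := TwoSidedIdeal {
  ideal0 : J 0;
  idealB : forall f g, J f -> J g -> J (f - g);
  idealZ : forall (c : F) f, J f -> J (c *: f);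
  idealMl : forall f g, J g -> J (pa_mul f g);
  idealMr : forall f g, J f -> J (pa_mul f g) }.

(* The two-sided ideal generated by the C_m(y_ij y_ji). *)
Definition cox_ideal (f : path_alg) : Prop :=
  forall J, two_sided_ideal J ->
    (forall i j m, M i j = Some m -> (3 <= m)%N -> J (cox_rel i j m)) -> J f.

Lemma cox_ideal_ideal : two_sided_ideal cox_ideal.
Proof.
split=> [|f g hf hg|c f hf|f g hg|f g hf] J idJ hJ.
- exact: ideal0.
- by apply: idealB => //; [apply: hf | apply: hg].
- by apply: idealZ => //; apply: hf.
- by apply: idealMl => //; apply: hg.
- by apply: idealMr => //; apply: hf.
Qed.

Definition cox_idealb : {pred path_alg} := fun f => `[< cox_ideal f >].

Lemma cox_idealb_closed : zmod_closed cox_idealb.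
Proof.
split=> [|f g /asboolP hf /asboolP hg]; apply/asboolP.
  exact: ideal0 cox_ideal_ideal.
exact: idealB cox_ideal_ideal _ _ hf hg.
Qed.

HB.instance Definition _ :=
  GRing.isZmodClosed.Build path_alg cox_idealb cox_idealb_closed.

(* The library quotients a Z-module by a boolean subgroup; the product is
   lifted to the quotient by [ca_mul], see [ca_projM]. *)
Definition cox_alg : zmodType := {ideal_quot cox_idealb}.

Local Open Scope quotient_scope.

Definition ca_mul : cox_alg -> cox_alg -> cox_alg :=
  lift_op2 {ideal_quot cox_idealb} pa_mul.

Definition ca_proj (f : path_alg) : cox_alg := \pi_{ideal_quot cox_idealb} f.

Lemma pa_mulEw (d1 d2 : {fset cox_path}) (f g : path_alg) :
  (msupp f `<=` d1)%fset -> (msupp g `<=` d2)%fset ->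
  pa_mul f g = \sum_(p <- d1) \sum_(q <- d2) (f@_p * g@_q) *: pa_cat p q.
Proof.
move=> s1 s2; rewrite /pa_mul (big_fset_incl _ s1) /=.
  apply: eq_bigr => p _; apply: big_fset_incl => // q _.
  by move/mcoeff_outdom => ->; rewrite mulr0 scale0r.
move=> p _ /mcoeff_outdom ->; apply: big1 => q _.
by rewrite mul0r scale0r.
Qed.

Lemma pa_mulBl (f g h : path_alg) : pa_mul (f - g) h = pa_mul f h - pa_mul g h.
Proof.
pose d := (msupp f `|` msupp g `|` msupp (f - g))%fset.
have sf : (msupp f `<=` d)%fset by rewrite /d -fsetUA fsubsetUl.
have sg : (msupp g `<=` d)%fset.
  by apply: fsubset_trans (fsubsetUl _ _); rewrite fsubsetUr.
have sfg : (msupp (f - g) `<=` d)%fset by rewrite /d fsubsetUr.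
rewrite (pa_mulEw sf (fsubset_refl _)) (pa_mulEw sg (fsubset_refl _)).
rewrite (pa_mulEw sfg (fsubset_refl _)) -sumrB; apply: eq_bigr => p _.
by rewrite -sumrB; apply: eq_bigr => q _; rewrite mcoeffB mulrBl scalerBl.
Qed.

Lemma pa_mulBr (f g h : path_alg) : pa_mul h (f - g) = pa_mul h f - pa_mul h g.
Proof.
pose d := (msupp f `|` msupp g `|` msupp (f - g))%fset.
have sf : (msupp f `<=` d)%fset by rewrite /d -fsetUA fsubsetUl.
have sg : (msupp g `<=` d)%fset.
  by apply: fsubset_trans (fsubsetUl _ _); rewrite fsubsetUr.
have sfg : (msupp (f - g) `<=` d)%fset by rewrite /d fsubsetUr.
rewrite (pa_mulEw (fsubset_refl _) sf) (pa_mulEw (fsubset_refl _) sg).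
rewrite (pa_mulEw (fsubset_refl _) sfg) -sumrB; apply: eq_bigr => p _.
by rewrite -sumrB; apply: eq_bigr => q _; rewrite mcoeffB mulrBr scalerBl.
Qed.

Lemma ca_projP (f g : path_alg) : ca_proj f = ca_proj g <-> cox_ideal (f - g).
Proof.
rewrite /ca_proj; split=> [/eqP|h]; last by apply/eqP; rewrite piE; apply/asboolP.
by rewrite piE => /asboolP.
Qed.

Lemma ca_projM (f g : path_alg) :
  ca_proj (pa_mul f g) = ca_mul (ca_proj f) (ca_proj g).
Proof.
rewrite /ca_mul; unlock; set f' := repr _; set g' := repr _.
have hf : cox_ideal (f - f') by apply/ca_projP; rewrite /f' [RHS]reprK.
have hg : cox_ideal (g - g') by apply/ca_projP; rewrite /g' [RHS]reprK.
apply/ca_projP.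
have -> : pa_mul f g - pa_mul f' g' = pa_mul (f - f') g - pa_mul f' (g' - g).
  by rewrite pa_mulBl pa_mulBr opprB addrA subrK.
apply: (idealB cox_ideal_ideal); first exact: (idealMr cox_ideal_ideal).
apply: (idealMl cox_ideal_ideal).
by rewrite -opprB -[- _]sub0r; apply: (idealB cox_ideal_ideal) => //; apply: ideal0 cox_ideal_ideal.
Qed.

Definition ca_vertex (i : I) : cox_alg := ca_proj (walk i [::]).

(* [s_i] R [s_j] *)
Definition ca_corner (i j : I) (x : cox_alg) : Prop :=
  exists y : cox_alg, x = ca_mul (ca_mul (ca_vertex i) y) (ca_vertex j).

End PathAlgebra.

(* Main.v *)
From HB Require Import structures.
From mathcomp Require Import all_boot all_order all_algebra.
From mathcomp Require Import finmap monalg zify.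
From Stdlib Require Import Rtrigo_def Rtrigo1.
From mathcomp Require Import Rstruct.
Require Import Defs.
Set Implicit Arguments.
Unset Strict Implicit.
Unset Printing Implicit Defensive.
Import Order.TTheory GRing.Theory Num.Theory.
Local Open Scope ring_scope.

(** P. M. Cohn's proof that a free product of domains over a field is a domain,
    carried over to the edges of a graph.  Along an edge {p, q} the alternating
    path of N steps is recorded as the monomial X^N, so the paths along this
    edge become the polynomials of a given parity modulo C_m(X^2) (or modulo 0
    if m is infinite).  As C_m is irreducible and C_m(0) <> 0, the product of
    two of them vanishes only if one of them does.  Cutting a path where it
    changes edge gives a word of syllables; letting paths act on the space
    spanned by the reduced words (van der Waerden's trick) shows that the
    reduced words form a basis of the quotient algebra.

    Let a b = 0 with a and b nonzero, and look at the words of a and b with the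
    largest number of syllables.  If a longest word of a and a longest word of
    b change edge where they meet, their concatenation survives in a b.  So all
    longest words of a end, and all those of b begin, on one edge: the leading
    parts are sums of u a_u and of b_v v, with a_u and b_v edge polynomials.
    The coefficients in a b of the words u X^N v with N > 0 show that every
    a_u b_v is a scalar, so that b_v is invertible, and a b_v has fewer
    syllables than a. *)

(** * Linear extensions *)

Section LinearExtension.
Variables (F : fieldType) (K : choiceType) (W : lmodType F).

Definition lext (h : K -> W) (a : {malg F[K]}) : W :=
  \sum_(k <- msupp a) a@_k *: h k.

Lemma lextEw (h : K -> W) (d : {fset K}) (a : {malg F[K]}) :
  (msupp a `<=` d)%fset -> lext h a = \sum_(k <- d) a@_k *: h k.
Proof.
move=> s; rewrite /lext (big_fset_incl _ s) // => k _ /mcoeff_outdom ->.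
by rewrite scale0r.
Qed.

Fact lext_is_linear (h : K -> W) : linear (lext h).
Proof.
move=> c a b; set d := (msupp a `|` msupp b `|` msupp (c *: a + b))%fset.
have sa : (msupp a `<=` d)%fset by rewrite /d -fsetUA fsubsetUl.
have sb : (msupp b `<=` d)%fset.
  by apply: fsubset_trans (fsubsetUl _ _); rewrite fsubsetUr.
have sc : (msupp (c *: a + b) `<=` d)%fset by rewrite /d fsubsetUr.
rewrite !(lextEw _ sa, lextEw _ sb, lextEw _ sc) scaler_sumr -big_split.
by apply: eq_bigr => k _; rewrite mcoeffD mcoeffZ scalerDl scalerA.
Qed.

HB.instance Definition _ h :=
  GRing.isLinear.Build F {malg F[K]} W *:%R (lext h) (lext_is_linear h).

Lemma lextU h k : lext h << k >> = h k.
Proof. by rewrite (lextEw _ msuppU_le) big_seq_fset1 mcoeffUU scale1r. Qed.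

Lemma eq_lext h h' (a : {malg F[K]}) :
  {in msupp a, h =1 h'} -> lext h a = lext h' a.
Proof.
by move=> e; rewrite /lext !big_seq; apply: eq_bigr => k ka; rewrite e.
Qed.

Lemma lextD h h' a : lext (fun k => h k + h' k) a = lext h a + lext h' a.
Proof. by rewrite -big_split; apply: eq_bigr => k _; rewrite scalerDr. Qed.

Lemma lextB h h' a : lext (fun k => h k - h' k) a = lext h a - lext h' a.
Proof. by rewrite -sumrB; apply: eq_bigr => k _; rewrite scalerBr. Qed.

Lemma lextZ h c a : lext (fun k => c *: h k) a = c *: lext h a.
Proof.
by rewrite scaler_sumr; apply: eq_bigr => k _; rewrite !scalerA mulrC.
Qed.

Lemma lext0 a : lext (fun=> 0) a = 0.
Proof. by apply: big1 => k _; rewrite scaler0. Qed.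

End LinearExtension.

Section LinearExtensionComp.
Variables (F : fieldType) (K : choiceType).

Lemma lext_comp (W W' : lmodType F) (g : {linear W -> W'}) (h : K -> W) a :
  g (lext h a) = lext (g \o h) a.
Proof. by rewrite linear_sum; apply: eq_bigr => k _; rewrite linearZ. Qed.

Lemma lext_id (a : {malg F[K]}) : lext (fun k => << k >>) a = a.
Proof.
rewrite {2}[a]monalgE; apply: eq_bigr => k _; apply/malgP => k'.
by rewrite mcoeffZ !mcoeffU mulrnAr mulr1.
Qed.

Lemma mcoeff_lext (K' : choiceType) (h : K -> {malg F[K']}) a k :
  (lext h a)@_k = lext (W := F^o) (fun x => (h x)@_k) a.
Proof.
by rewrite raddf_sum; apply: eq_bigr => x _ /=; rewrite mcoeffZ.
Qed.

Lemma mcoeff_as_lext (a : {malg F[K]}) k :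
  lext (W := F^o) (fun x => (x == k)%:R) a = a@_k.
Proof.
rewrite -[in RHS](lext_id a) mcoeff_lext; apply: eq_lext => x _.
by rewrite mcoeffU.
Qed.

Lemma lext_support (K' : choiceType) (P : pred K') (h : K -> {malg F[K']}) a :
  (forall k, k \in msupp a -> {subset msupp (h k) <= P}) ->
  {subset msupp (lext h a) <= P}.
Proof.
move=> hP t; rewrite -mcoeff_neq0 mcoeff_lext; apply: contraR => tP.
rewrite (eq_lext (h' := fun=> 0)) ?lext0 // => k /hP/(_ t) kt.
apply/eqP; rewrite mcoeff_eq0; apply: contra tP; exact: kt.
Qed.

End LinearExtensionComp.

Section PolyExtension.
Variables (F : fieldType) (W : lmodType F).

(** The linear map on F[X] that sends X^n to [h n]. It turns polynomials attached to an edge into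
    combinations of paths or words. *)
Definition pext (h : nat -> W) (f : {poly F}) : W :=
  \sum_(n < size f) f`_n *: h n.

Lemma pextEw h (f : {poly F}) d :
  (size f <= d)%N -> pext h f = \sum_(n < d) f`_n *: h n.
Proof.
move=> s; rewrite /pext (big_ord_widen d (fun n => f`_n *: h n)) //.
rewrite big_mkcond; apply: eq_bigr => n _ /=; case: ltnP => // /leq_sizeP -> //.
by rewrite scale0r.
Qed.

Fact pext_is_linear h : linear (pext h).
Proof.
move=> c f g; set d := maxn (size (c *: f + g)%R) (maxn (size f) (size g)).
have sf : (size f <= d)%N by rewrite /d !leq_max leqnn orbT.
have sg : (size g <= d)%N by rewrite /d !leq_max leqnn !orbT.
have sc : (size (c *: f + g)%R <= d)%N by rewrite /d leq_maxl.
rewrite !(pextEw _ sf, pextEw _ sg, pextEw _ sc) scaler_sumr -big_split.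
by apply: eq_bigr => k _; rewrite coefD coefZ scalerDl scalerA.
Qed.

HB.instance Definition _ h :=
  GRing.isLinear.Build F {poly F} W *:%R (pext h) (pext_is_linear h).

Lemma pextXn h n : pext h 'X^n = h n.
Proof.
rewrite /pext size_polyXn big_ord_recr /= coefXn eqxx scale1r big1 ?add0r //.
by move=> k _; rewrite coefXn ltn_eqF ?scale0r.
Qed.

Lemma pextC h c : pext h c%:P = c *: h 0%N.
Proof. by rewrite -alg_polyC linearZ /= -(expr0 'X) pextXn. Qed.

Lemma eq_pext h h' (f : {poly F}) : (forall n, f`_n != 0 -> h n = h' n) ->
  pext h f = pext h' f.
Proof.
move=> e; apply: eq_bigr => n _; have [->|/e ->//] := eqVneq f`_n 0.
by rewrite !scale0r.
Qed.

End PolyExtension.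

Section PolyExtensionComp.
Variables (F : fieldType).

Lemma pext_comp (W W' : lmodType F) (g : {linear W -> W'}) (h : nat -> W)
    (f : {poly F}) :
  g (pext h f) = pext (g \o h) f.
Proof. by rewrite linear_sum; apply: eq_bigr => k _; rewrite linearZ. Qed.

Lemma pextM (W : lmodType F) (h : nat -> W) (f : {poly F}) g :
  pext h (f * g) = pext (fun m => pext (fun n => h (m + n)%N) g) f.
Proof.
rewrite -[f in LHS]coefK poly_def mulr_suml linear_sum; apply: eq_bigr => m _.
rewrite -scalerAl linearZ /=; congr (_ *: _).
rewrite -[g in LHS]coefK poly_def mulr_sumr linear_sum; apply: eq_bigr => n _.
by rewrite -scalerAr linearZ /= -exprD pextXn.
Qed.

Lemma pext_compX2 (W : lmodType F) (h : nat -> W) (p : {poly F}) :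
  pext h (p \Po 'X^2) = pext (fun n => h (n * 2)%N) p.
Proof.
rewrite -[p in LHS]coefK poly_def linear_sum /= linear_sum.
apply: eq_bigr => n _; rewrite comp_polyZ linearZ /=; congr (_ *: _).
by rewrite comp_Xn_poly -exprM mulnC pextXn.
Qed.

Lemma mcoeff_pext (K : choiceType) (h : nat -> {malg F[K]}) (f : {poly F}) k :
  (pext h f)@_k = \sum_(n < size f) f`_n * (h n)@_k.
Proof. by rewrite raddf_sum; apply: eq_bigr => n _ /=; rewrite mcoeffZ. Qed.

Lemma pext_support (K : choiceType) (P : pred K) (h : nat -> {malg F[K]})
    (f : {poly F}) :
  (forall n, f`_n != 0 -> {subset msupp (h n) <= P}) ->
  {subset msupp (pext h f) <= P}.
Proof.
move=> hP t; rewrite -mcoeff_neq0 mcoeff_pext; apply: contraR => tP.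
apply/eqP/big1 => n _; have [->|/hP/(_ t) nt] := eqVneq f`_n 0.
  by rewrite mul0r.
rewrite (_ : _@_t = 0) ?mulr0 //; apply/eqP; rewrite mcoeff_eq0.
by apply: contra tP; apply: nt.
Qed.

End PolyExtensionComp.

Section ExtensionExchange.
Variables (F : fieldType) (K K' : choiceType).

Lemma pext_lext (W : lmodType F) (h : nat -> K -> W) (f : {poly F}) a :
  pext (fun n => lext (h n) a) f = lext (fun k => pext (h^~ k) f) a.
Proof.
rewrite /pext /lext; under eq_bigr do rewrite scaler_sumr.
rewrite exchange_big; apply: eq_bigr => k _; rewrite scaler_sumr.
by apply: eq_bigr => n _; rewrite !scalerA mulrC.
Qed.

Lemma lext_exchange (W : lmodType F) (h : K -> K' -> W) a b :
  lext (fun z => lext (h z) b) a = lext (fun z' => lext (h^~ z') a) b.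
Proof.
rewrite /lext; under eq_bigr do rewrite scaler_sumr.
rewrite exchange_big; apply: eq_bigr => z _; rewrite scaler_sumr.
by apply: eq_bigr => z' _; rewrite !scalerA mulrC.
Qed.

Lemma lext_mul (h : K -> {poly F}) (h' : K' -> {poly F}) a b :
  lext h a * lext h' b = lext (fun k => lext (fun k' => h k * h' k') b) a.
Proof.
rewrite mulr_suml; apply: eq_bigr => k _; rewrite -scalerAl mulr_sumr.
by congr (_ *: _); apply: eq_bigr => k' _; rewrite scalerAr.
Qed.

Lemma lext_modp (h : K -> {poly F}) d a :
  lext h a %% d = lext (fun k => h k %% d) a.
Proof.
rewrite (big_morph (fun f => f %% d) (modpD d) (mod0p d)).
by apply: eq_bigr => k _; rewrite modpZl.
Qed.

Lemma coef_lext (h : K -> {poly F}) a n :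
  (lext h a)`_n = lext (W := F^o) (fun k => (h k)`_n) a.
Proof. by rewrite coef_sum; apply: eq_bigr => k _; rewrite coefZ. Qed.

End ExtensionExchange.

(** * Polynomials of constant parity *)

Section Parity.
Variable F : fieldType.
Implicit Types (f g D : {poly F}).

(** Alternating paths along one edge with the same two ends have lengths of the same parity. The
    polynomial 0 has both parities. *)
Definition parity_poly (e : bool) f := forall n, f`_n != 0 -> odd n = e.

Lemma parity_polyP e f : parity_poly e f ->
  exists g, f = (g \Po 'X^2) * 'X^e.
Proof.
case: e => pf.
  exists (odd_poly f); apply/polyP => -[|n];
    rewrite coefMXn coef_comp_poly_Xn //=.
    by apply/eqP; apply: contraT => /pf.
  rewrite subSS subn0 dvdn2 divn2 coef_odd_poly.
  case: (boolP (odd n)) => [on|en] /=; last by rewrite even_halfK.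
  by apply/eqP; apply: contraT => /pf /=; rewrite on.
exists (even_poly f); apply/polyP => n.
rewrite expr0 mulr1 coef_comp_poly_Xn //.
rewrite dvdn2 divn2 coef_even_poly.
case: (boolP (odd n)) => [on|en] /=; last by rewrite even_halfK.
by apply/eqP; apply: contraT => /pf; rewrite on.
Qed.

Lemma comp_polyX2_parity g (e : bool) : parity_poly e ((g \Po 'X^2) * 'X^e).
Proof.
move=> n; rewrite coefMXn; case: ltnP => [_|le]; first by rewrite eqxx.
rewrite coef_comp_poly_Xn // dvdn2; case: ifP => [|_]; last by rewrite eqxx.
by rewrite oddB // oddb negb_add => /eqP.
Qed.

Lemma parity_polyX n : parity_poly (odd n) 'X^n.
Proof.
by move=> m; rewrite coefXn; have [->|] := eqVneq m n; rewrite ?eqxx.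
Qed.

Lemma parity_polyM e e' f g : parity_poly e f -> parity_poly e' g ->
  parity_poly (e (+) e') (f * g).
Proof.
move=> pf pg n; rewrite coefM; apply: contraNeq => ne; apply/eqP/big1 => k _.
have [->|/pf ok] := eqVneq f`_k 0; first by rewrite mul0r.
have [->|/pg] := eqVneq g`_(n - k) 0; first by rewrite mulr0.
have kn : (k <= n)%N by rewrite -ltnS.
rewrite oddB // ok => ek; case/eqP: ne; rewrite -ek.
by rewrite addbCA addbb addbF.
Qed.

Lemma size_comp_polyX2 g : g != 0 -> size (g \Po 'X^2) = ((size g).-1 * 2).+1.
Proof.
move=> g0; rewrite -[size _]prednK ?size_comp_poly ?size_polyXn //.
by rewrite lt0n size_poly_eq0 comp_poly_eq0 // size_polyXn.
Qed.

(** Write f = g(X^2) X^e with e at most 1. For D nonzero, (g mod D)(X^2) X^e still has degree below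
    2 deg D, so it is the remainder by uniqueness of Euclidean division. *)
Lemma modp_parity e f D : parity_poly e f -> parity_poly e (f %% (D \Po 'X^2)).
Proof.
have [->|D0] := eqVneq D 0; first by rewrite comp_poly0 modp0.
move/parity_polyP => [g ->].
set r := ((g %% D) \Po 'X^2) * 'X^e.
suff -> : ((g \Po 'X^2) * 'X^e) %% (D \Po 'X^2) = r.
  exact: comp_polyX2_parity.
apply/esym/(@modpP _ _ (((g %/ D) \Po 'X^2) * 'X^e)).
  rewrite {1}(divp_eq g D) comp_polyD comp_polyM.
  by rewrite /r mulrDl -!mulrA [_ * 'X^e]mulrC.
rewrite /r; have [->|r0] := eqVneq (g %% D) 0.
  by rewrite comp_poly0 mul0r size_poly0 size_comp_polyX2.
rewrite size_mulXn ?comp_poly_eq0 ?size_polyXn // !size_comp_polyX2 //.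
have lt : (size (g %% D)%R < size D)%N by rewrite ltn_modp.
have : (0 < size (g %% D)%R)%N by rewrite lt0n size_poly_eq0.
have : (e <= 1)%N by exact: leq_b1.
by case: (size _) lt => // a; case: (size D) => // b /=; lia.
Qed.

End Parity.

(** * Division by D(X^2) *)

Section Modulus.
Variable F : fieldType.
Implicit Types (f g D : {poly F}).

(** The modulus 0 belongs to the label infinity; the condition at 0 makes D(X^2) coprime to X. *)
Definition good_modulus D := D = 0 \/ irreducible_poly D /\ ~~ root D 0.

Lemma irreducible_dvd_mul D f g : irreducible_poly D -> D %| f * g ->
  (D %| f) || (D %| g).
Proof.
move=> irr; case: (boolP (D %| f)) => //= nDf.
by rewrite Gauss_dvdpr // irreducible_poly_coprime.
Qed.

Lemma dvdp_comp_polyX2 D f : D != 0 -> (D \Po 'X^2 %| f \Po 'X^2) = (D %| f).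
Proof.
move=> D0; apply/idP/idP => [|/dvdpP[h ->]]; last first.
  by rewrite comp_polyM dvdp_mulIr.
rewrite {1}(divp_eq f D) comp_polyD comp_polyM dvdp_addr ?dvdp_mulIr //.
rewrite /dvdp; have [->//|r0] := eqVneq (f %% D) 0.
move=> /dvdp_leq; rewrite comp_poly_eq0 ?size_polyXn // => /(_ r0).
rewrite !size_comp_polyX2 // ltnS leq_pmul2r // leqNgt.
have : (size (f %% D)%R < size D)%N by rewrite ltn_modp.
have : (0 < size (f %% D)%R)%N by rewrite lt0n size_poly_eq0.
by case: (size _) => // a _; case: (size D) => // b /=; rewrite ltnS => ->.
Qed.

(** D(X^2) may be reducible (it is X^2 - 1 for m = 3), whence the constant parity: up to a power of
    X, which is coprime to D(X^2), both factors are polynomials in X^2, and irreducibility of D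
    applies to these. *)
Lemma parity_poly_dvd_mul e e' D f g : good_modulus D ->
  parity_poly e f -> parity_poly e' g ->
  D \Po 'X^2 %| f * g -> (D \Po 'X^2 %| f) || (D \Po 'X^2 %| g).
Proof.
case=> [->|[irr D0]]; first by rewrite comp_poly0 !dvd0p mulf_eq0.
move=> /parity_polyP[f' ->] /parity_polyP[g' ->].
have cop n : coprimep (D \Po 'X^2) 'X^n.
  apply: coprimep_expr; rewrite coprimepX.
  by move: D0; rewrite !rootE horner_comp !hornerE expr0n.
have N0 := irredp_neq0 irr.
rewrite mulrACA -exprD Gauss_dvdpl // -comp_polyM !Gauss_dvdpl //.
by rewrite !dvdp_comp_polyX2 //; apply: irreducible_dvd_mul.
Qed.

Lemma modp_sum I (r : seq I) (P : pred I) (h : I -> {poly F}) D :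
  (\sum_(i <- r | P i) h i) %% D = \sum_(i <- r | P i) (h i %% D).
Proof. exact: (big_morph (fun f => f %% D) (modpD D) (mod0p D)). Qed.

Lemma pext_modXn (W : lmodType F) (g : {linear {poly F} -> W}) D f f' :
  pext (fun n => g ((f' * 'X^n) %% D)) f = g ((f' * f) %% D).
Proof.
rewrite -[f in RHS]coefK poly_def mulr_sumr modp_sum linear_sum.
by apply: eq_bigr => n _; rewrite -scalerAr modpZl linearZ.
Qed.

Lemma good_modulus_size D : good_modulus D ->
  D = 0 \/ (1 < size (D \Po 'X^2))%N.
Proof.
case=> [->|[irr _]]; [by left|right].
rewrite size_comp_polyX2 ?irredp_neq0 //.
by case: irr => [+ _]; case: (size D) => [|[]].
Qed.
End Modulus.

(** * Reduced words and their product *)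

Section NormalForm.
Variables (F : fieldType) (I : choiceType).
Variables (edge : rel I) (D : I -> I -> {poly F}).
Hypothesis edge_irr : irreflexive edge.
Hypothesis edge_sym : symmetric edge.
Hypothesis D_sym : forall p q, D p q = D q p.
Hypothesis D_good : forall p q, edge p q -> good_modulus (D p q).

(* (p, q, N) is the alternating path p q p ... of N steps.  In Dz below the
   modulus is 0 for an edge labelled infinity. *)
Definition syllable : choiceType := [the choiceType of (I * I * nat)%type].
Local Notation mono := (seq syllable).
Local Notation V := {malg F[mono]}.
Implicit Types (p q i j k x : I) (n m N : nat) (s u w : mono) (f g : {poly F}).
Implicit Types (t : syllable).

Definition Dz p q := D p q \Po 'X^2.

Lemma DzC p q : Dz p q = Dz q p. Proof. by rewrite /Dz D_sym. Qed.

(** * Alternating paths along an edge *)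

Fixpoint alt p q N : seq I := if N is N'.+1 then q :: alt q p N' else [::].

Definition altend p q N := if odd N then q else p.

Lemma last_alt p q N : last p (alt p q N) = altend p q N.
Proof.
elim: N p q => //= N IH p q; rewrite IH /altend /=.
by case: odd.
Qed.

Lemma altend_add p q m n :
  altend (altend p q m) (altend q p m) n = altend p q (m + n).
Proof. by rewrite /altend oddD; case: odd; case: odd. Qed.

Lemma alt_add p q m n :
  alt p q (m + n) = alt p q m ++ alt (altend p q m) (altend q p m) n.
Proof.
by elim: m p q => //= m IH p q; rewrite IH /altend /=; case: odd.
Qed.

Lemma altend_edge p q N : edge p q -> edge (altend p q N) (altend q p N).
Proof. by rewrite /altend; case: odd => //; rewrite edge_sym. Qed.

Lemma Dz_altend p q N : Dz (altend p q N) (altend q p N) = Dz p q.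
Proof. by rewrite /altend; case: odd; rewrite // DzC. Qed.

Lemma altend_inj p q m n : edge p q ->
  altend p q m = altend p q n -> odd m = odd n.
Proof.
move=> e; rewrite /altend; case: odd; case: odd => // E; move: e.
  by rewrite E edge_irr.
by rewrite E edge_irr.
Qed.

(** * Reduced words and their leading syllable *)

Definition onedge p q t := (t.1 == (p, q)) || (t.1 == (q, p)).
Definition nohd p q s := if s is t :: _ then ~~ onedge p q t else true.
(** [hexp] and [htl] split off a leading syllable on {p, q}; if there is none, the exponent is 0 and
    the tail is [s]. [ecat] glues them together again, X^0 being no syllable. *)
Definition hexp p q s :=
  if s is t :: _ then if onedge p q t then t.2 else 0%N else 0%N.
Definition htl p q s :=
  if s is t :: s' then if onedge p q t then s' else s else s.
Definition ecat p q N s : mono := if N is 0 then s else (p, q, N) :: s.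
(** X^N is reduced: N is below the degree of [Dz], hence N.+1 below its size. *)
Definition redexp p q N := (D p q == 0) || (N.+1 < size (Dz p q))%N.

Fixpoint vfrom i s :=
  if s is t :: s' then
    [&& t.1.1 == i, edge t.1.1 t.1.2, (0 < t.2)%N, redexp t.1.1 t.1.2 t.2,
        nohd t.1.1 t.1.2 s' & vfrom (altend t.1.1 t.1.2 t.2) s']
  else true.

Definition mend i s := foldl (fun _ t => altend t.1.1 t.1.2 t.2) i s.
Definition vlist s := flatten [seq alt t.1.1 t.1.2 t.2 | t <- s].

Lemma onedgeC p q t : onedge p q t = onedge q p t.
Proof. by rewrite /onedge orbC. Qed.

Lemma onedge_sym t t' : onedge t.1.1 t.1.2 t' = onedge t'.1.1 t'.1.2 t.
Proof.
case: t t' => [[a b] c] [[a' b'] c']; rewrite /onedge /= !xpair_eqE.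
by rewrite [a' == a]eq_sym [b' == b]eq_sym [a' == b]eq_sym [b' == a]eq_sym
  [X in _ || X]andbC.
Qed.

Lemma onedge_trans p q t t' : onedge p q t ->
  onedge p q t' = onedge t.1.1 t.1.2 t'.
Proof. by case/orP => /eqP->; rewrite // onedgeC. Qed.

Lemma nohdC p q s : nohd p q s = nohd q p s.
Proof. by case: s => //= t s; rewrite onedgeC. Qed.

Lemma hexpC p q s : hexp p q s = hexp q p s.
Proof. by case: s => //= t s; rewrite onedgeC. Qed.

Lemma htlC p q s : htl p q s = htl q p s.
Proof. by case: s => //= t s; rewrite onedgeC. Qed.

Lemma nohd_altend p q N s : nohd (altend p q N) (altend q p N) s = nohd p q s.
Proof. by rewrite /altend; case: odd => //; rewrite nohdC. Qed.

Lemma hexp_altend p q N s : hexp (altend p q N) (altend q p N) s = hexp p q s.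
Proof. by rewrite /altend; case: odd => //; rewrite hexpC. Qed.

Lemma htl_altend p q N s : htl (altend p q N) (altend q p N) s = htl p q s.
Proof. by rewrite /altend; case: odd => //; rewrite htlC. Qed.

Lemma redexp_altend p q n N :
  redexp (altend p q n) (altend q p n) N = redexp p q N.
Proof. by rewrite /altend /redexp; case: odd => //; rewrite DzC D_sym. Qed.

Lemma redexp_mod p q N : redexp p q N -> 'X^N %% Dz p q = 'X^N.
Proof.
case/orP => [/eqP D0|le]; first by rewrite /Dz D0 comp_poly0 modp0.
by rewrite modp_small // size_polyXn.
Qed.

Lemma redexp0 p q : edge p q -> redexp p q 0.
Proof.
by move/D_good/good_modulus_size => [D0|h]; rewrite /redexp ?D0 ?eqxx ?h ?orbT.
Qed.

Lemma hexp_nohd p q s : nohd p q s -> hexp p q s = 0%N.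
Proof. by case: s => //= t s /negbTE ->. Qed.

Lemma htl_nohd p q s : nohd p q s -> htl p q s = s.
Proof. by case: s => //= t s /negbTE ->. Qed.

Lemma hexp_ecat p q N s : nohd p q s -> hexp p q (ecat p q N s) = N.
Proof. by case: N => [|N] h /=; [rewrite hexp_nohd | rewrite /onedge eqxx]. Qed.

Lemma htl_ecat p q N s : nohd p q s -> htl p q (ecat p q N s) = s.
Proof. by case: N => [|N] h /=; [rewrite htl_nohd | rewrite /onedge eqxx]. Qed.

Lemma vfrom_split p q s : edge p q -> vfrom p s ->
  [/\ s = ecat p q (hexp p q s) (htl p q s), nohd p q (htl p q s),
      vfrom (altend p q (hexp p q s)) (htl p q s),
      redexp p q (hexp p q s) & (size (htl p q s) <= size s)%N].
Proof.
move=> e; case: s => [|[[p' q'] N] s] /=; first by rewrite redexp0.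
case/and5P => /eqP-> e' N0 r /andP[nh v].
rewrite /onedge /= !xpair_eqE eqxx /=.
have -> : (p == q) && (q' == p) = false.
  by apply/negP => /andP[/eqP E _]; move: e; rewrite E edge_irr.
rewrite orbF; have [Eq|ne] := eqVneq q' q.
  by subst q'; case: N N0 r nh v => // N _ r nh v; split=> //=.
split=> //=; rewrite ?redexp0 //; last by rewrite eqxx e' N0 r nh v.
rewrite /onedge /= !xpair_eqE eqxx /= (negbTE ne) /=.
by apply/negP => /andP[/eqP E _]; move: e; rewrite E edge_irr.
Qed.

Lemma vfrom_ecat p q N s : edge p q -> redexp p q N -> nohd p q s ->
  vfrom (altend p q N) s -> vfrom p (ecat p q N s).
Proof.
by move=> e r nh v; case: N r v => [|N] //= r v; rewrite eqxx e r nh v.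
Qed.

Lemma mend_ecat p q N s : mend p (ecat p q N s) = mend (altend p q N) s.
Proof. by case: N. Qed.

Lemma vlist_ecat p q N s : vlist (ecat p q N s) = alt p q N ++ vlist s.
Proof. by case: N. Qed.

Lemma vlist_cat s u : vlist (s ++ u) = vlist s ++ vlist u.
Proof. by rewrite /vlist map_cat flatten_cat. Qed.

Lemma last_vlist i s : vfrom i s -> last i (vlist s) = mend i s.
Proof.
elim: s i => //= t s IH i /and5P[/eqP<- _ _ _ /andP[_ /IH <-]].
by rewrite last_cat last_alt.
Qed.

Lemma mend_cat i s u : mend i (s ++ u) = mend (mend i s) u.
Proof. exact: foldl_cat. Qed.

Lemma size_ecat p q N s : size (ecat p q N s) = ((0 < N) + size s)%N.
Proof. by case: N. Qed.

(** * The action of paths on words *)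

Definition epoly p q s f : V := pext (fun N => << ecat p q N s >>) f.

HB.instance Definition _ p q s := GRing.isLinear.Build F {poly F} V *:%R
  (epoly p q s) (pext_is_linear (fun N => << ecat p q N s >>)).

Lemma epolyXn p q N s : epoly p q s 'X^N = << ecat p q N s >>.
Proof. exact: pextXn. Qed.

(* Left multiplication by the edge from p to q. *)
Definition step p q s : V :=
  epoly p q (htl p q s) ('X^((hexp p q s).+1) %% Dz p q).

(** The last edge acts first, so concatenation of paths becomes composition. *)
Fixpoint act i (l : seq I) (v : V) : V :=
  if l is x :: l' then lext (step i x) (act x l' v) else v.

Fact act_is_linear i l : linear (act i l).
Proof. by elim: l i => //= x l IH i c v v'; rewrite IH linearP. Qed.

HB.instance Definition _ i l :=
  GRing.isLinear.Build F V V *:%R (act i l) (act_is_linear i l).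

Lemma act_cat i l l' v : act i (l ++ l') v = act i l (act (last i l) l' v).
Proof. by elim: l i => //= x l IH i; rewrite IH. Qed.

Lemma lext_step_epoly p q s f : nohd p q s ->
  lext (step p q) (epoly q p s f) = epoly p q s (('X * f) %% Dz p q).
Proof.
move=> nh; rewrite /epoly pext_comp.
rewrite -(pext_modXn (pext (fun N => << ecat p q N s >>)) _ f).
apply: eq_pext => n _ /=; rewrite lextU /step hexpC htlC.
by rewrite hexp_ecat ?htl_ecat 1?nohdC // exprS.
Qed.

(** Each step multiplies the leading edge polynomial by X modulo [Dz], so N steps add N to the
    leading exponent and one reduction suffices. *)
Lemma act_alt p q N s : edge p q -> vfrom (altend p q N) s ->
  act p (alt p q N) << s >>
    = epoly p q (htl p q s) ('X^(N + hexp p q s) %% Dz p q).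
Proof.
elim: N p q => [|N IH] p q e v.
  have [Es _ _ r _] := vfrom_split e v.
  by rewrite add0n redexp_mod // epolyXn -Es.
have e' : edge q p by rewrite edge_sym.
have v' : vfrom (altend q p N) s by move: v; rewrite /altend /=; case: odd.
rewrite /= IH // lext_step_epoly; last first.
  by have [_ ? _ _ _] := vfrom_split (altend_edge N e') v';
     rewrite nohdC -(nohd_altend _ _ N) -(htl_altend _ _ N).
by rewrite hexpC htlC [Dz q p]DzC modp_mul -exprS addSn.
Qed.

Definition vspace i k n : pred mono :=
  fun s => [&& vfrom i s, mend i s == k & (size s <= n)%N].

Lemma nil_vspace k : {subset msupp (<< [::] >> : V) <= vspace k k 0}.
Proof.
move=> s /(fsubsetP msuppU_le); rewrite in_fset1 => /eqP ->.
by rewrite unfold_in /vspace /= eqxx.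
Qed.

(** N enters only through its parity, which determines where the alternating paths end and is
    preserved by reduction modulo [Dz]. At most one syllable is put before [s]. *)
Lemma epoly_support p q N k f s n : edge p q -> vfrom (altend p q N) s ->
  mend (altend p q N) s = k -> nohd p q s -> (size s < n)%N ->
  parity_poly (odd N) f ->
  {subset msupp (epoly p q s (f %% Dz p q)) <= vspace p k n}.
Proof.
move=> e v m nh ls par; apply: pext_support => K fK t /(fsubsetP msuppU_le).
rewrite in_fset1 => /eqP ->; rewrite unfold_in /vspace.
have oK : odd K = odd N by exact: (modp_parity (D := D p q) par fK).
have eK : altend p q K = altend p q N by rewrite /altend oK.
have r : redexp p q K.
  rewrite /redexp; have [//|D0] := eqVneq (D p q) 0; rewrite /=.
  have : (size (f %% Dz p q)%R < size (Dz p q))%N.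
    by rewrite ltn_modp comp_poly_eq0 ?size_polyXn.
  apply: leq_trans; rewrite ltnNge; apply: contra fK => le.
  by rewrite nth_default.
rewrite vfrom_ecat ?eK // mend_ecat eK m eqxx size_ecat /=.
by apply: leq_trans ls; case: (0 < K)%N; rewrite ?add0n ?leqnSn.
Qed.

Lemma act_alt_support p q N k n (v : V) : edge p q ->
  {subset msupp v <= vspace (altend p q N) k n} ->
  {subset msupp (act p (alt p q N) v) <= vspace p k n.+1}.
Proof.
move=> e vP; rewrite -[v in msupp (act _ _ v)]lext_id lext_comp.
apply: lext_support => s /vP /and3P[vs /eqP ms ls] /=.
rewrite act_alt //.
have [Es nh v' _ lt] := vfrom_split (altend_edge N e) vs.
rewrite hexp_altend htl_altend nohd_altend in nh v' lt Es.
apply: (epoly_support (N := N + hexp p q s)) => //.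
- by rewrite -altend_add.
- by rewrite -altend_add -ms [in RHS]Es mend_ecat.
- exact: leq_trans ls.
- exact: parity_polyX.
Qed.

Lemma act_support i k l n (v : V) : path edge i l ->
  {subset msupp v <= vspace (last i l) k n} ->
  {subset msupp (act i l v) <= vspace i k (size l + n)}.
Proof.
elim: l i => //= x l IH i /andP[e pl] vP.
exact: (act_alt_support (N := 1) e) (IH _ pl vP).
Qed.

Lemma act_vlist_support i k n s (v : V) : vfrom i s ->
  {subset msupp v <= vspace (mend i s) k n} ->
  {subset msupp (act i (vlist s) v) <= vspace i k (size s + n)}.
Proof.
elim: s i => //= -[[p q] N] s IH i /and5P[/eqP <- e N0 r /andP[nh vs]] vP.
rewrite [vlist _]/= -/(vlist s) act_cat last_alt.
exact: (act_alt_support e (IH _ vs vP)).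
Qed.


(** The relations hold in the action: on a word with leading exponent h, f acts through X^h f modulo
    [Dz], which depends only on f modulo [Dz]. *)
Lemma act_alt_mod p q (e : bool) f (v : V) : edge p q -> parity_poly e f ->
  {subset msupp v <= vfrom (altend p q e)} ->
  pext (fun N => act p (alt p q N) v) f
    = pext (fun N => act p (alt p q N) v) (f %% Dz p q).
Proof.
move=> e' par vP; have par' : parity_poly e (f %% Dz p q).
  exact: (modp_parity (D := D p q) par).
have E g : parity_poly e g -> pext (fun N => act p (alt p q N) v) g
    = lext (fun s => epoly p q (htl p q s) (('X^(hexp p q s) * g) %% Dz p q)) v.
  move=> parg; rewrite -[v in LHS]lext_id.
  under [in LHS]eq_pext do rewrite lext_comp.
  rewrite pext_lext; apply: eq_lext => s /vP vs.
  rewrite -(pext_modXn (epoly p q (htl p q s)) _ g); apply: eq_pext => N gN /=.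
  rewrite act_alt ?exprD 1?mulrC //.
  have oN := parg _ gN.
  by move: vs; rewrite /altend oN oddb.
rewrite !E //; apply: eq_lext => s _.
by rewrite modp_mul.
Qed.

Lemma vlist_path i s : vfrom i s -> path edge i (vlist s).
Proof.
have alt_path p q N : edge p q -> path edge p (alt p q N).
  by elim: N p q => //= N IH p q e; rewrite e IH // edge_sym.
elim: s i => //= t s IH i /and5P[/eqP<- e _ _ /andP[_ /IH]].
by rewrite [vlist _]/= -/(vlist s) cat_path last_alt alt_path.
Qed.

(** * The product of words and its associativity *)

Definition star i (a b : V) : V := lext (fun s => act i (vlist s) b) a.

Lemma star_lext (K : choiceType) i (h : K -> V) (a : {malg F[K]}) b :
  star i (lext h a) b = lext (fun y => star i (h y) b) a.
Proof. by rewrite {1}/star lext_comp. Qed.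

Lemma star_pext i (h : nat -> V) f b :
  star i (pext h f) b = pext (fun N => star i (h N) b) f.
Proof. by rewrite {1}/star pext_comp. Qed.

Lemma starU i s b : star i << s >> b = act i (vlist s) b.
Proof. by rewrite /star lextU. Qed.

Fact star_is_linear i a : linear (star i a).
Proof.
move=> c b b'; rewrite /star -lextZ -lextD; apply: eq_lext => s _.
by rewrite linearP.
Qed.

HB.instance Definition _ i a :=
  GRing.isLinear.Build F V V *:%R (star i a) (star_is_linear i a).

Lemma vspaceW i k n s : s \in vspace i k n -> vfrom i s.
Proof. by case/and3P. Qed.

Lemma star_support i j k n n' (a b : V) :
  {subset msupp a <= vspace i j n} -> {subset msupp b <= vspace j k n'} ->
  {subset msupp (star i a b) <= vspace i k (n + n')}.
Proof.
move=> aP bP; apply: lext_support => s /aP /and3P[vs /eqP ms ls] t.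
have := act_vlist_support (k := k) (n := n') vs.
rewrite ms => /(_ _ bP t) h /h /and3P[vt mt lt].
apply/and3P; split=> //; apply: leq_trans lt _.
by rewrite leq_add2r.
Qed.

Lemma star_epoly p q s f b : star p (epoly p q s f) b
  = pext (fun N => act p (alt p q N) (act (altend p q N) (vlist s) b)) f.
Proof.
rewrite star_pext; apply: eq_pext => N _.
by rewrite starU vlist_ecat act_cat last_alt.
Qed.

(** Putting an edge before s may cause a reduction modulo [Dz]. Let y be the tail of s applied to c:
    the two sides apply the same edge polynomial to y, after and before this reduction. *)
Lemma star_step p q s j k n n' (c : V) : edge p q -> s \in vspace q j n ->
  {subset msupp c <= vspace j k n'} ->
  star p (step p q s) c = act p [:: q] (act q (vlist s) c).
Proof.
move=> e /and3P[vs /eqP ms _] cP; have e' : edge q p by rewrite edge_sym.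
have [Es nh v' _ _] := vfrom_split e' vs.
rewrite /step hexpC htlC.
move: (hexp q p s) (htl q p s) Es nh v' => h s' Es nh v'.
have odd_end N : odd N = odd h.+1 -> altend p q N = altend q p h.
  by rewrite /altend /= => ->; case: odd.
rewrite Es vlist_ecat act_cat last_alt star_epoly.
set y := act (altend q p h) (vlist s') c.
have yP : {subset msupp y <= vspace (altend q p h) k (size s' + n')}.
  by apply: act_vlist_support => //; rewrite -mend_ecat -Es ms.
have par : parity_poly (odd h.+1) ('X^(h.+1) : {poly F}) by apply: parity_polyX.
transitivity (pext (fun N => act p (alt p q N) y) ('X^(h.+1) %% Dz p q)).
  apply: eq_pext => N cN; rewrite odd_end //.
  exact: (modp_parity (D := D p q) par cN).
rewrite -(act_alt_mod e par) ?pextXn // => t /yP /vspaceW.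
by rewrite [vfrom _ _]/= -(odd_end (odd h.+1)) ?oddb.
Qed.

Lemma star_act i j k l n n' (v c : V) : path edge i l ->
  {subset msupp v <= vspace (last i l) j n} ->
  {subset msupp c <= vspace j k n'} ->
  star i (act i l v) c = act i l (star (last i l) v c).
Proof.
elim: l i => //= x l IH i /andP[e pl] vP cP.
have sP := act_support pl vP.
rewrite star_lext -[in RHS](IH x) // {2}/star lext_comp.
apply: eq_lext => s /sP sx /=.
by rewrite (star_step e sx cP).
Qed.

Lemma starA i j k l n n' n'' (a b c : V) :
  {subset msupp a <= vspace i j n} -> {subset msupp b <= vspace j k n'} ->
  {subset msupp c <= vspace k l n''} ->
  star i (star i a b) c = star i a (star j b c).
Proof.
move=> aP bP cP; rewrite {2}/star star_lext; apply: eq_lext => s.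
move=> /aP /and3P[vs /eqP ms _].
have e : last i (vlist s) = j by rewrite last_vlist.
by rewrite (star_act (vlist_path vs) (j := k) (n := n') _ cP) e.
Qed.

(** * Concatenation of reduced words *)

Definition junction s u := if rev s is t :: _ then nohd t.1.1 t.1.2 u else true.

Lemma junction_rcons s t u : junction (rcons s t) u = nohd t.1.1 t.1.2 u.
Proof. by rewrite /junction rev_rcons. Qed.

Lemma vfrom_cat i s u :
  vfrom i (s ++ u) = [&& vfrom i s, vfrom (mend i s) u & junction s u].
Proof.
case/lastP: s => [|s t]; first by rewrite /junction /= andbT.
rewrite junction_rcons; elim: s i => [|t' s IH] i /=.
  by rewrite !andbT -!andbA; do 4 congr (_ && _); rewrite andbC.
rewrite IH -!andbA; do 4 congr (_ && _).
by congr (_ && _); case: s {IH}.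
Qed.

Lemma vfrom_rcons i s t : vfrom i (rcons s t) =
  [&& vfrom i s, t.1.1 == mend i s, edge t.1.1 t.1.2, (0 < t.2)%N,
      redexp t.1.1 t.1.2 t.2 & nohd t.1.1 t.1.2 (rev s)].
Proof.
rewrite -cats1 vfrom_cat /= !andbT; congr (_ && _); rewrite -!andbA.
do 4 congr (_ && _); rewrite /junction.
by case: (rev s) => //= t' _; rewrite onedge_sym.
Qed.

Lemma act_vlist_cat i s u : vfrom i (s ++ u) ->
  act i (vlist s) << u >> = << s ++ u >>.
Proof.
elim: s i => //= -[[p q] N] s IH i /and5P[/eqP<- /= e N0 r /andP[nh v]].
rewrite [vlist _]/= -/(vlist s) act_cat last_alt IH // act_alt //.
rewrite hexp_nohd // htl_nohd // addn0 redexp_mod // epolyXn.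
by case: N N0 {r v}.
Qed.

Lemma star_nil i j n (a : V) : {subset msupp a <= vspace i j n} ->
  star i a << [::] >> = a.
Proof.
move=> aP; rewrite -[RHS]lext_id; apply: eq_lext => s /aP /vspaceW vs.
by rewrite act_vlist_cat cats0.
Qed.


(** * Coefficients of long words in a product *)

(** The term N = 0 brings u and v together and yields at most |u| + |v| syllables, fewer than w has.
    For N > 0 the word u X^N v is reduced and appears unchanged. *)
Lemma coef_act_epoly i u p q v n f w : vfrom i u -> mend i u = p ->
  edge p q -> nohd p q (rev u) -> nohd p q v -> vfrom (altend p q n) v ->
  parity_poly (odd n) f -> (size u + size v < size w)%N ->
  (act i (vlist u) (epoly p q v (f %% Dz p q)))@_w
  = \sum_(N < size (f %% Dz p q)%R)
      (f %% Dz p q)`_N *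
      ((0 < N)%N && (u ++ (p, q, nat_of_ord N) :: v == w))%:R.
Proof.
move=> vu mu e nu nv vv par lw; rewrite [epoly _ _ _ _]/epoly.
rewrite pext_comp mcoeff_pext.
apply: eq_bigr => N _.
have [->|cN] := eqVneq ((f %% Dz p q)`_N) 0; first by rewrite !mul0r.
congr (_ * _); case: N cN => -[|N] _ /= cN.
  have v0 : vfrom p v.
    move: (modp_parity (D := D p q) par cN) vv => /= E.
    by rewrite /altend -E.
  apply/eqP; rewrite mcoeff_eq0; apply/negP.
  have h : {subset msupp (<< v >> : V)
      <= vspace (mend i u) (mend p v) (size v)}.
    move=> t /(fsubsetP msuppU_le); rewrite in_fset1 => /eqP ->.
    by rewrite unfold_in /vspace mu v0 eqxx leqnn.
  move/(act_vlist_support vu h); rewrite unfold_in => /and3P[_ _].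
  by rewrite leqNgt lw.
have h : {subset msupp (epoly p q v (f %% Dz p q)) <= vfrom p}.
  by move=> t /(epoly_support e vv erefl nv (ltnSn _) par) /vspaceW.
(* This word is reduced because it lies in the support of the edge polynomial, its coefficient there
   being nonzero by [cN]. *)
have r : vfrom p ((p, q, N.+1) :: v).
  apply: (h (ecat p q N.+1 v)); rewrite -mcoeff_neq0 mcoeff_pext.
  have lN : (N.+1 < size (f %% Dz p q)%R)%N.
    by rewrite ltnNge; apply: contra cN => le; rewrite nth_default.
  rewrite (bigD1 (Ordinal lN)) //= mcoeffUU mulr1 big1 ?addr0 //.
  move=> [K lK] /= ne.
  rewrite mcoeffU; case: eqP => [E|_]; last by rewrite mulr0.
  have := congr1 (hexp p q) E; rewrite hexp_ecat // -[_ :: _]/(ecat p q N.+1 v).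
  by rewrite hexp_ecat // => EK; case/eqP: ne; apply: val_inj.
rewrite act_vlist_cat ?mcoeffU // vfrom_cat vu mu r /=.
move: nu; rewrite /junction; case: (rev u) => //= t _.
by rewrite onedge_sym.
Qed.

(** Extended linearly, this collects the edge polynomial standing before the tail [u]. For the ends
    of words it is applied to reversed lists; the single syllables keep their direction, to which
    [onedge] is insensitive. *)
Definition hpoly p q u s : {poly F} :=
  if htl p q s == u then 'X^(hexp p q s) else 0.

Lemma vfrom_tail_split i p q u s : edge p q -> vfrom i s -> mend i u = p ->
  htl p q (rev s) = rev u -> s = u ++ ecat p q (hexp p q (rev s)) [::].
Proof.
move=> e; case/lastP: s => [|s t].
  by move=> _ _ /esym/(congr1 rev); rewrite revK => ->.
rewrite vfrom_rcons rev_rcons /= => /and5P[vs /eqP mt et t0 _] mu.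
case: ifP => [/orP on|_ /esym].
  move/(can_inj revK) => E; subst u; case: t on mt et t0 => [[a b] N] /=.
  case=> /eqP[Ea Eb]; subst a b; last first.
    by move=> Eq; move: e; rewrite -mu Eq edge_irr.
  by case: N => // N _ _ _; rewrite cats1.
by rewrite -rev_rcons => /(can_inj revK) ->; rewrite /= cats0.
Qed.

Lemma act_merge i s t t' u : vfrom i (rcons s t) ->
  vfrom (mend i (rcons s t)) (t' :: u) -> onedge t.1.1 t.1.2 t' ->
  act i (vlist (rcons s t)) << t' :: u >>
  = act i (vlist s) (epoly t.1.1 t.1.2 u ('X^(t.2 + t'.2) %% Dz t.1.1 t.1.2)).
Proof.
move=> v1; rewrite -cats1 mend_cat /= => v2 on.
move: v1; rewrite vfrom_rcons => /and5P[vs /eqP mt e t0 _].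
rewrite vlist_cat act_cat last_vlist // -mt /vlist /= cats0.
rewrite act_alt //.
by rewrite /= on.
Qed.

Lemma merge_data i s t t' u : vfrom i (rcons s t) ->
  vfrom (mend i (rcons s t)) (t' :: u) -> onedge t.1.1 t.1.2 t' ->
  [/\ nohd t.1.1 t.1.2 u, vfrom (altend t.1.1 t.1.2 (t.2 + t'.2)) u &
      t'.1 = (altend t.1.1 t.1.2 t.2, altend t.1.2 t.1.1 t.2)].
Proof.
rewrite -cats1 mend_cat /= => v1 /and5P[/eqP m' e' t0' _ /andP[nh vu]] on.
move: v1; rewrite cats1 vfrom_rcons => /and5P[vs /eqP mt e t0 _].
case: t on e e' nh vu m' mt {t0} => [[p q] N].
case: t' {t0'} => [[p' q'] N'] /=.
move=> on e e' nh vu m' mt.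
have E : (p', q') = (altend p q N, altend q p N).
  rewrite m'; congr (_, _); move: on m' e'; rewrite /onedge /= /altend.
  by case/orP => /eqP[-> ->]; case: odd => // ->; rewrite edge_irr.
case: E => E1 E2; subst p' q'.
by rewrite -altend_add; split=> //; rewrite -(nohd_altend p q N).
Qed.

(** If s and w meet on one edge, their product has at most |s| + |w| - 1 syllables, too few for u ++
    v. Otherwise it is s ++ w, and the lengths force s = u and w = v. *)
Lemma act_coef_top i s w u v : vfrom i s -> vfrom (mend i s) w ->
  vfrom i (u ++ v) -> (size s <= size u)%N -> (size w <= size v)%N ->
  (act i (vlist s) << w >>)@_(u ++ v) = ((s == u) && (w == v))%:R.
Proof.
move=> vs vw vuv ls lw; case: (boolP (junction s w)) => [J|].
  rewrite act_vlist_cat ?vfrom_cat ?vs ?vw // mcoeffU; congr (nat_of_bool _)%:R.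
  have [Es|ns] /= := eqVneq s u; first by subst u; rewrite eqseq_cat ?eqxx.
  have [Eu|nu] := eqVneq (size s) (size u).
    by rewrite eqseq_cat // (negbTE ns).
  apply/negbTE; apply: contra nu => /eqP/(congr1 size); rewrite !size_cat => E.
  by apply/eqP; lia.
case/lastP: s vs vw ls => [|s t] vs vw ls; first by rewrite /junction.
case: w vw lw => [|t' w] vw lw; rewrite junction_rcons //= => /negPn on.
have [nh vw' _] := merge_data vs vw on.
have ne : (rcons s t == u) && (t' :: w == v) = false.
  apply/negP => /andP[/eqP E1 /eqP E2]; subst u v.
  by move: vuv; rewrite vfrom_cat junction_rcons /= on !andbF.
rewrite act_merge // ne.
move: vs; rewrite vfrom_rcons => /and5P[vs /eqP mt e t0 /andP[_ ns]].
rewrite size_rcons in ls; rewrite /= in lw.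
rewrite (coef_act_epoly (n := t.2 + t'.2)) //; first last.
- by rewrite size_cat -addnS leq_add // ltnW.
- exact: parity_polyX.
apply: big1 => K _; have [E|_] := eqVneq; last by rewrite andbF mulr0.
have /(congr1 size) := E; rewrite !size_cat /= => Ez.
by have := leq_add ls lw; rewrite -Ez addSn ltnn.
Qed.


(** With one more syllable allowed on each side, u X^N v arises only from s = u X^A and w = X^B v,
    where A or B may be 0. Its coefficient is then that of X^N in X^(A+B) modulo [Dz]. *)
Lemma act_coef_near i s w p q u v N : vfrom i s -> vfrom (mend i s) w ->
  edge p q -> mend i u = p -> nohd p q (rev u) -> nohd p q v -> (0 < N)%N ->
  (size s <= (size u).+1)%N -> (size w <= (size v).+1)%N ->
  (act i (vlist s) << w >>)@_(u ++ (p, q, N) :: v)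
  = ((hpoly p q (rev u) (rev s) * hpoly p q v w) %% Dz p q)`_N.
Proof.
move=> vs vw e mu nu nv N0 ls lw.
have [/andP[/eqP E1 /eqP E2]|nE] :=
  boolP ((htl p q (rev s) == rev u) && (htl p q w == v)); last first.
  transitivity (0 : F); last first.
    move: nE; rewrite /hpoly; case: eqP => _; case: eqP => _ //=;
    by rewrite ?mul0r ?mulr0 mod0p coef0.
  apply/eqP; apply: contraR nE; case: (boolP (junction s w)) => [J|].
    rewrite act_vlist_cat ?vfrom_cat ?vs ?vw // mcoeffU.
    (* Without a merge, the lengths leave s = u or s = u X^N, and both have the required form. *)
    have [E _|_] := eqVneq (s ++ w) (u ++ (p, q, N) :: v); last by rewrite eqxx.
    have [Eu|nu'] := eqVneq (size s) (size u).
      move/eqP: E; rewrite eqseq_cat // => /andP[/eqP-> /eqP->].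
      by rewrite htl_nohd // /= /onedge !eqxx.
    have ls' : size s = size (rcons u (p, q, N)).
      have := congr1 size E; rewrite !size_cat size_rcons /=.
      by move: ls lw nu'; clear; move: (size s) (size w) (size u) (size v); lia.
    move/eqP: E; rewrite -cat_rcons eqseq_cat // => /andP[/eqP-> /eqP->].
    by rewrite rev_rcons /= htl_nohd // /onedge !eqxx.
  case/lastP: s vs vw ls => [|s t] vs vw ls; first by rewrite /junction.
  case: w vw lw => [|t' w] vw lw; rewrite junction_rcons //= => /negPn on.
  have [nh vw' _] := merge_data vs vw on.
  rewrite act_merge //.
  move: vs; rewrite vfrom_rcons => /and5P[vs /eqP mt et t0 /andP[_ ns]].
  rewrite size_rcons ltnS in ls; rewrite /= ltnS in lw.
  rewrite (coef_act_epoly (n := t.2 + t'.2)) //; first last.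
  - by rewrite size_cat /= addnS ltnS leq_add.
  - exact: parity_polyX.
  apply: contraR => nE; apply/eqP/big1 => K _.
  have [E|_] := eqVneq; last by rewrite andbF mulr0.
  case/negP: nE; have Ez := congr1 size E; rewrite !size_cat /= in Ez.
  (* Here s and w have lost the merged syllables, so s X^K w is long enough only if |s| = |u| and
     |w| = |v|. *)
  have ls' : size s = size u.
    by move: ls lw Ez; clear; move: (size s) (size w) (size u) (size v); lia.
  move/eqP: E; rewrite eqseq_cat // eqseq_cons => /and3P[/eqP-> E /eqP->].
  move: E; rewrite !xpair_eqE => /andP[/andP[/eqP Ep /eqP Eq] _].
  have ont : onedge p q t by rewrite /onedge -Ep -Eq -surjective_pairing eqxx.
  by rewrite rev_rcons /= ont (onedge_trans t' ont) on !eqxx.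
rewrite /hpoly E1 E2 !eqxx -exprD.
have Es := vfrom_tail_split e vs mu E1.
set A := hexp p q (rev s) in Es *; clearbody A; subst s.
have ms : mend i (u ++ ecat p q A [::]) = altend p q A.
  by rewrite mend_cat mu mend_ecat.
rewrite ms in vw; have [_ nh vv _ _] := vfrom_split (altend_edge A e) vw.
rewrite hexp_altend htl_altend altend_add E2 in vv.
move: vs; rewrite vfrom_cat => /and3P[vu _ _].
rewrite vlist_cat act_cat last_vlist // mu vlist_ecat cats0 act_alt // E2.
rewrite (coef_act_epoly vu mu e nu nv vv); first last.
- by rewrite size_cat ltn_add2l.
- exact: parity_polyX.
set f := _ %% _; rewrite -[in RHS](coefK f) poly_def coef_sum.
apply: eq_bigr => K _; rewrite coefZ coefXn; congr (_ * (nat_of_bool _)%:R).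
rewrite eqseq_cat // eqxx /= eqseq_cons eqxx andbT xpair_eqE eqxx /= eq_sym.
by case: eqP => [<-|_]; rewrite ?N0 ?andbF.
Qed.

Lemma mcoeff_star i a b w : (star i a b)@_w = lext (W := F^o)
  (fun s => lext (W := F^o) (fun u => (act i (vlist s) << u >>)@_w) b) a.
Proof.
rewrite /star mcoeff_lext; apply: (eq_lext (W := F^o)) => s _.
by rewrite -[b in LHS]lext_id lext_comp mcoeff_lext.
Qed.

Lemma star_coef_near i j k a b p q u v N :
  {subset msupp a <= vspace i j (size u).+1} ->
  {subset msupp b <= vspace j k (size v).+1} ->
  edge p q -> mend i u = p -> nohd p q (rev u) -> nohd p q v -> (0 < N)%N ->
  (star i a b)@_(u ++ (p, q, N) :: v)
  = ((lext (fun s => hpoly p q (rev u) (rev s)) a * lext (hpoly p q v) b)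
       %% Dz p q)`_N.
Proof.
move=> aP bP e mu nu nv N0; rewrite lext_mul lext_modp coef_lext mcoeff_star.
apply: (eq_lext (W := F^o)) => s /aP /and3P[vs /eqP ms ls].
rewrite lext_modp coef_lext.
apply: (eq_lext (W := F^o)) => w /bP /and3P[vw _ lw].
by rewrite act_coef_near // ms.
Qed.

Lemma star_coef_top i j k a b u v : vfrom i (u ++ v) ->
  {subset msupp a <= vspace i j (size u)} ->
  {subset msupp b <= vspace j k (size v)} ->
  (star i a b)@_(u ++ v) = a@_u * b@_v.
Proof.
move=> vuv aP bP; rewrite mcoeff_star -[in RHS](mcoeff_as_lext b v).
rewrite [RHS]mulrC -[in RHS](mcoeff_as_lext a u) -[RHS](lextZ (W := F^o)).
apply: (eq_lext (W := F^o)) => s /aP /and3P[vs /eqP ms ls].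
rewrite [RHS]mulrC -[RHS](lextZ (W := F^o)).
apply: (eq_lext (W := F^o)) => w /bP /and3P[vw _ lw].
by rewrite act_coef_top ?ms // -[RHS]natrM mulnb.
Qed.


Lemma ecat_inj p q m n u : nohd p q u -> ecat p q m u = ecat p q n u -> m = n.
Proof. by move=> nu /(congr1 (hexp p q)); rewrite !hexp_ecat. Qed.

Lemma coef_tail_poly i j n p q u a N : {subset msupp a <= vspace i j n} ->
  edge p q -> mend i u = p -> nohd p q (rev u) ->
  (lext (fun s => hpoly p q (rev u) (rev s)) a)`_N = a@_(u ++ ecat p q N [::]).
Proof.
move=> aP e mu nu; rewrite coef_lext -[RHS]mcoeff_as_lext.
apply: (eq_lext (W := F^o)) => s /aP /and3P[vs _ _]; rewrite /hpoly.
have [E|nE] := eqVneq (htl p q (rev s)) (rev u); last first.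
  rewrite coef0; have [Es|//] := eqVneq s (u ++ ecat p q N [::]); case/eqP: nE.
  have -> : rev s = ecat p q N (rev u) by rewrite Es rev_cat; case: (N).
  by rewrite htl_ecat.
rewrite coefXn; congr (nat_of_bool _)%:R.
rewrite [in RHS](vfrom_tail_split e vs mu E) eqseq_cat // eqxx /=.
apply/eqP/eqP => [->//|/(ecat_inj (isT : nohd p q [::])) -> //].
Qed.

Lemma coef_head_poly j k n q v b N : {subset msupp b <= vspace j k n} ->
  edge j q -> nohd j q v ->
  (lext (hpoly j q v) b)`_N = b@_(ecat j q N v).
Proof.
move=> bP e nv; rewrite coef_lext -[RHS]mcoeff_as_lext.
apply: (eq_lext (W := F^o)) => s /bP /and3P[vs _ _]; rewrite /hpoly.
have [E|nE] := eqVneq (htl j q s) v; last first.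
  rewrite coef0; have [Es|//] := eqVneq s (ecat j q N v); case/eqP: nE.
  by rewrite Es htl_ecat.
rewrite coefXn; congr (nat_of_bool _)%:R.
have [Es _ _ _ _] := vfrom_split e vs; rewrite [in RHS]Es E.
by apply/eqP/eqP => [->//|/(ecat_inj nv) -> //].
Qed.

Lemma redexp_modp p q f :
  (forall N, f`_N != 0 -> redexp p q N) -> f %% Dz p q = f.
Proof.
move=> rf; have [->|f0] := eqVneq f 0; first exact: mod0p.
have /rf/orP [/eqP D0|lt] : f`_(size f).-1 != 0 by rewrite lead_coef_eq0.
  by rewrite /Dz D0 comp_poly0 modp0.
by rewrite modp_small // -[size f]prednK // lt0n size_poly_eq0.
Qed.

Lemma hpoly_altend p q n u s :
  hpoly (altend p q n) (altend q p n) u s = hpoly p q u s.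
Proof. by rewrite /hpoly htl_altend hexp_altend. Qed.

(** Acting by f and then by g along the edge is acting by g f, and the equal parities bring the
    paths back to the vertex where x starts. Hence g f may be replaced by its remainder c. *)
Lemma star_edge_scalar p q A B f g c k n (x : V) : edge p q ->
  parity_poly (odd A) f -> parity_poly (odd B) g -> odd A = odd B ->
  (f * g) %% Dz p q = c%:P -> {subset msupp x <= vspace (altend p q A) k n} ->
  star (altend p q A) (epoly (altend p q A) (altend q p A) [::] g)
    (pext (fun N => act p (alt p q N) x) f) = c *: x.
Proof.
move=> e pf pg AB fg xP; set j := altend p q A; set j' := altend q p A.
have e' : edge j j' by apply: altend_edge.
have back N : odd N = odd B -> altend j j' N = p /\ altend j' j N = q.
  by rewrite -AB /j /j' /altend => ->; case: odd.
rewrite star_epoly.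
transitivity (pext (fun m => pext (fun N => act j (alt j j' (m + N)) x) f) g).
  apply: eq_pext => m gm; have [b1 b2] := back _ (pg _ gm).
  rewrite b1 /vlist /= pext_comp; apply: eq_pext => N fN /=.
  by rewrite alt_add b1 b2 act_cat last_alt b1.
rewrite -(pextM (fun m => act j (alt j j' m) x)).
rewrite (act_alt_mod (e := false)) //.
- by rewrite Dz_altend mulrC fg pextC.
- by rewrite -(addbb (odd A)) {2}AB addbC; apply: parity_polyM.
- by move=> s /xP /vspaceW.
Qed.

(** * Absence of zero divisors *)

Lemma exists_max_size (a : V) : a != 0 ->
  exists2 s, s \in msupp a & forall u, u \in msupp a -> (size u <= size s)%N.
Proof.
move=> a0; pose P n := has (fun s => size s == n) (msupp a).
have exP : exists n, P n.
  have [s sa] : exists s, s \in msupp a.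
    have [s sa|none] := pickP (fun s : msupp a => true).
      by exists (val s); apply: valP.
    case/eqP: a0; apply/malgP => s; rewrite mcoeff0; apply/eqP.
    by rewrite mcoeff_eq0; apply/negP => sa; have := none [` sa]%fset.
  by exists (size s); apply/hasP; exists s.
have ubP n : P n -> (n <= \max_(s <- msupp a) size s)%N.
  by case/hasP => s sa /eqP <-; rewrite (big_rem s) //= leq_maxl.
case: (ex_maxnP exP ubP) => n /hasP[s sa /eqP <-] mx.
by exists s => // u ua; apply: mx; apply/hasP; exists u.
Qed.


(** Induction on the syllable bound n of [a]. The bound n' of [b] is left free, because in the
    descent [b] may gain a syllable while [a] loses one. *)
Theorem star_domain n i j k n' (a b : V) :
  {subset msupp a <= vspace i j n} -> {subset msupp b <= vspace j k n'} ->
  star i a b = 0 -> a = 0 \/ b = 0.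
Proof.
elim/ltn_ind: n i j k n' a b => n IH i j k n' a b aP bP ab0.
have [->|a0] := eqVneq a 0; first by left.
have [->|b0] := eqVneq b 0; first by right.
exfalso.
have [s0 s0a smax] := exists_max_size a0.
have [w0 w0b wmax] := exists_max_size b0.
have aP' s : s \in msupp a -> s \in vspace i j (size s0).
  move=> sa; have /and3P[vs ms _] := aP _ sa.
  by apply/and3P; split=> //; apply: smax.
have bP' w : w \in msupp b -> w \in vspace j k (size w0).
  move=> wb; have /and3P[vw mw _] := bP _ wb.
  by apply/and3P; split=> //; apply: wmax.
(* At a junction the coefficient of s ++ w in the product would be a_s b_w, which is nonzero. *)
have nojunction s w : s \in msupp a -> w \in msupp b ->
    size s = size s0 -> size w = size w0 -> ~~ junction s w.
  move=> sa wb ls lw; apply/negP => J.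
  have /and3P[vs /eqP ms _] := aP _ sa; have /and3P[vw _ _] := bP _ wb.
  have vsw : vfrom i (s ++ w) by rewrite vfrom_cat vs ms vw.
  have := star_coef_top (a := a) (b := b) (j := j) (k := k) vsw.
  rewrite ls lw ab0 mcoeff0 => /(_ aP' bP')/esym/eqP.
  by rewrite mulf_eq0 !mcoeff_eq0 sa wb.
have J0 := nojunction _ _ s0a w0b erefl erefl.
have [u0 [[[p q] A] Es0]] : exists u0 t, s0 = rcons u0 t.
  by case/lastP: s0 J0 {s0a smax aP' nojunction} => [//|u t] _; exists u, t.
have [[[j1 j'] B] [v0 Ew0]] : exists t v0, w0 = t :: v0.
  move: J0; rewrite Es0 junction_rcons.
  by case: w0 {w0b wmax bP' nojunction} => [//|t v] _; exists t, v.
have sz0 : size s0 = (size u0).+1 by rewrite Es0 size_rcons.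
have szw0 : size w0 = (size v0).+1 by rewrite Ew0.
have /and3P[vs0 /eqP ms0 ns0] := aP _ s0a.
have /and3P[vw0 /eqP mw0 _] := bP _ w0b.
rewrite Es0 in vs0 ms0; rewrite Ew0 -ms0 in vw0.
have on : onedge p q (j1, j', B).
  by move: J0; rewrite Es0 Ew0 junction_rcons /= negbK.
have [nv0 vv0 /= [Ej1 Ej']] := merge_data vs0 vw0 on.
move: vs0; rewrite vfrom_rcons /= => /and5P[vu0 /eqP mu0 e A0 /andP[rA nu0]].
have Ej : j = altend p q A by rewrite -ms0 -cats1 mend_cat.
rewrite -Ej in Ej1; subst j1.
have e' : edge j j' by rewrite Ej Ej'; apply: altend_edge.
have nv0' : nohd j j' v0 by rewrite Ej Ej' nohd_altend.
have B0 : (0 < B)%N by move: vw0 => /= /and4P[].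
(* f and g are the edge polynomials that [a] carries after [u0] and [b] carries before [v0]. *)
set f := lext (fun s => hpoly p q (rev u0) (rev s)) a.
set g := lext (hpoly p q v0) b.
have fE N : f`_N = a@_(u0 ++ ecat p q N [::]).
  exact: coef_tail_poly aP e (esym mu0) nu0.
have gE N : g`_N = b@_(ecat j j' N v0).
  have -> : g = lext (hpoly j j' v0) b.
    by apply: eq_lext => s _; rewrite Ej Ej' hpoly_altend.
  exact: coef_head_poly bP e' nv0'.
have fA : f`_A != 0.
  rewrite fE mcoeff_neq0; move: s0a; rewrite Es0 -cats1.
  by case: (A) A0.
have gB : g`_B != 0.
  by rewrite gE mcoeff_neq0; move: w0b; rewrite Ew0; case: (B) B0.
(* All words of [a] end at j and all words of [b] end at k; this fixes the parity of the exponents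
   in f and in g. *)
have f_supp N : f`_N != 0 -> redexp p q N /\ altend p q N = j.
  rewrite fE mcoeff_neq0 => /aP /and3P[].
  rewrite vfrom_cat mend_cat -mu0 mend_ecat => /and3P[_ v _] /eqP/= <- _.
  by have [_ _ _ + _] := vfrom_split e v; rewrite hexp_ecat.
have g_supp N : g`_N != 0 -> redexp p q N /\ altend j j' N = altend j j' B.
  rewrite gE mcoeff_neq0 => /bP /and3P[v m _].
  have [_ _ vv r _] := vfrom_split e' v.
  rewrite hexp_ecat // htl_ecat // in vv r.
  rewrite Ej Ej' redexp_altend in r; split=> //.
  move: m; rewrite mend_ecat -mw0 Ew0 /=.
  move: vv0 vv; rewrite -altend_add /= -Ej -Ej'; clear.
  case: v0 => [|t v] /=; first by move=> _ _ /eqP.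
  by case/andP => /eqP <- _ /andP[/eqP -> _].
have fpar : parity_poly (odd A) f.
  by move=> N /f_supp[_]; rewrite Ej; apply: altend_inj.
have gpar : parity_poly (odd B) g.
  by move=> N /g_supp[_]; apply: altend_inj e'.
have fmod : f %% Dz p q = f by apply: redexp_modp => N /f_supp[].
have gmod : g %% Dz p q = g by apply: redexp_modp => N /g_supp[].
(* These are coefficients of the zero product at the words u X^N v0. The parity of l tells at which
   end of the edge u stops. *)
have coef0_near u p1 q1 l N : size u = size u0 -> p1 = altend p q l ->
    q1 = altend q p l -> mend i u = p1 -> nohd p1 q1 (rev u) -> (0 < N)%N ->
    ((lext (fun s => hpoly p1 q1 (rev u) (rev s)) a * g) %% Dz p1 q1)`_N = 0.
  move=> su E1 E2 mu nu N0; subst p1 q1.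
  have eg : g = lext (hpoly (altend p q l) (altend q p l) v0) b.
    by apply: eq_lext => s _; rewrite hpoly_altend.
  rewrite eg -(star_coef_near (i := i) (j := j) (k := k)) ?ab0 ?mcoeff0 //.
  - by rewrite su -sz0.
  - by rewrite -szw0.
  - exact: altend_edge.
  - by rewrite nohd_altend.
have [c Ec] : exists c, (f * g) %% Dz p q = c%:P.
  exists ((f * g) %% Dz p q)`_0; apply/polyP => -[|N]; rewrite coefC //=.
  by apply: (coef0_near u0 p q 0%N).
(* If c were 0, then f or g would be divisible by [Dz], hence 0, as both are reduced. *)
have c0 : c != 0.
  apply/eqP => c0; move/eqP: Ec; rewrite c0 polyC0 -/(_ %| _) => dv.
  case/orP: (parity_poly_dvd_mul (D_good e) fpar gpar dv) => /modp_eq0.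
    by rewrite fmod => f0; case/eqP: fA; rewrite f0 coef0.
  by rewrite gmod => g0; case/eqP: gB; rewrite g0 coef0.
(* A nonzero constant is even, and f g modulo [Dz] has the parity of A + B. *)
have AB : odd A = odd B.
  have /modp_parity : parity_poly (odd A (+) odd B) (f * g).
    exact: parity_polyM.
  move=> /(_ (D p q) 0%N); rewrite [_ %% _]Ec coefC /= => /(_ c0).
  by case: odd; case: odd.
have end_p : altend j j' B = p by rewrite Ej Ej' /altend -AB; case: odd.
(* [b1] is g as an element from j to p, and [lift] is left multiplication by f; [b1_lift] expresses
   g f = c. *)
set b1 := epoly j j' [::] g.
have b1P : {subset msupp b1 <= vspace j p 1}.
  rewrite /b1 -gmod -(Dz_altend p q A) -Ej -Ej' -end_p.
  exact: (epoly_support (N := B)).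
pose lift (y : V) : V := pext (fun N => act p (alt p q N) y) f.
have liftP (y : V) m k' : {subset msupp y <= vspace j k' m} ->
    {subset msupp (lift y) <= vspace p k' m.+1}.
  move=> yP; apply: pext_support => N /f_supp[_ EN].
  by apply: act_alt_support => //; rewrite EN.
have b1_lift (y : V) m k' : {subset msupp y <= vspace j k' m} ->
    star j b1 (lift y) = c *: y.
  by rewrite /b1 Ej Ej' => yP; exact: (star_edge_scalar e fpar gpar AB Ec yP).
set a1 := star i a b1.
have a1_lift (y : V) m k' : {subset msupp y <= vspace j k' m} ->
    star i a1 (lift y) = c *: star i a y.
  move=> yP; rewrite (starA aP b1P (liftP _ _ _ yP)) (b1_lift _ _ _ yP).
  by rewrite linearZ.
have heads w : w \in msupp b1 -> (w == [::]) || ~~ nohd j j' w.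
  apply: (pext_support (P := fun w => (w == [::]) || ~~ nohd j j' w)).
  move=> N _ u /(fsubsetP msuppU_le); rewrite in_fset1 => /eqP ->.
  by case: N => [|N] //=; rewrite unfold_in /= /onedge eqxx.
have edge_w0 t1 t : onedge j j' t ->
    onedge t1.1.1 t1.1.2 t = onedge t1.1.1 t1.1.2 (j, j', B).
  by move=> ont; rewrite onedge_sym -(onedge_trans t1 ont) [RHS]onedge_sym.
(* The descent: [a1] is shorter than [a]. A longer word s t in it would have |s| = |s0| or |s| =
   |u0|, and its coefficient is shown to vanish in both cases. *)
have a1P : {subset msupp a1 <= vspace i p (size u0)}.
  move=> w wa1; have /and3P[vw mw lw] := star_support aP' b1P wa1.
  apply/and3P; split=> //; rewrite leqNgt; apply/negP => gt.
  move: wa1; rewrite -mcoeff_neq0 => /negP; apply; apply/eqP.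
  case/lastP: w vw {mw} lw gt => [//|s t] vw.
  rewrite sz0 size_rcons addn1 !ltnS => lw gt.
  have [ls|nls] := eqVneq (size s) (size s0).
    (* The coefficient is that of s in [a] times that of t in [b1]. If both are nonzero, t lies on
       the edge on which [w0] begins, so s has a junction with [w0] too, against [nojunction]. *)
    rewrite -cats1 (star_coef_top (j := j) (k := p)) ?cats1 ?ls //.
    apply/eqP; rewrite mulf_eq0 !mcoeff_eq0 -negb_and.
    apply/negP => /andP[sa tb].
    have ont : onedge j j' t by have /= := heads _ tb; rewrite negbK.
    have := nojunction _ _ sa w0b ls erefl.
    move: vw; rewrite -cats1 vfrom_cat => /and3P[_ _].
    rewrite /junction Ew0; case: (rev s) => //= t1 _.
    by rewrite edge_w0 // => ->.
  have ls : size s = size u0.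
    apply/eqP; rewrite eqn_leq gt andbT -ltnS ltn_neqAle lw andbT.
    by rewrite -sz0.
  move: vw; rewrite vfrom_rcons => /and5P[vs /eqP mt e1 N0 /andP[_ nh]].
  have -> : rcons s t = s ++ (t.1.1, t.1.2, t.2) :: [::].
    by rewrite cats1; case: (t) => [[]].
  rewrite (star_coef_near (j := j) (k := p)) ?ls -?sz0 //.
  (* For t on {p, q} the second factor is g and [coef0_near] applies. Otherwise both factors are
     constant: a word s X^N of [a] with N > 0 on the edge of t would be a longest one with a
     junction to [w0], and [b1] has no syllable on that edge. *)
  have [ont|nont] := boolP (onedge p q t).
    have [l [E1 E2]] : exists l, t.1.1 = altend p q l /\ t.1.2 = altend q p l.
      by case/orP: ont => /eqP ->; [exists 0%N | exists 1%N].
    have -> : lext (hpoly t.1.1 t.1.2 [::]) b1 = g.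
      rewrite /b1 pext_comp -[RHS](coefK g) poly_def.
      apply: eq_bigr => N _ /=; rewrite lextU E1 E2 hpoly_altend.
      by rewrite -(hpoly_altend p q A) -Ej -Ej' /hpoly htl_ecat // hexp_ecat.
    by apply: (coef0_near s _ _ l) => //; rewrite ls.
  set f1 := lext _ a; set g1 := lext _ b1.
  have nont' : onedge t.1.1 t.1.2 (j, j', B) = false.
    rewrite onedge_sym /= Ej Ej'; apply/negbTE; apply: contra nont.
    by rewrite /onedge /altend /=; case: odd => //; rewrite orbC.
  have nont'' N : onedge t.1.1 t.1.2 (j, j', N) = false by [].
  have f1E : f1 = (f1`_0)%:P.
    apply/polyP => -[|N]; rewrite coefC //=.
    rewrite (coef_tail_poly _ aP) //; apply/eqP; rewrite mcoeff_eq0.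
    apply/negP => sa; have := nojunction _ _ sa w0b.
    rewrite cats1 size_rcons ls -sz0 => /(_ erefl erefl).
    by rewrite junction_rcons Ew0 /= nont'.
  have g1E : g1 = (g`_0)%:P.
    rewrite /g1 /b1 pext_comp (pextEw _ (leqnSn _)) big_ord_recl big1 => [|N _].
      by rewrite /= lextU /hpoly /= addr0 alg_polyC.
    by rewrite /= lextU /hpoly /= nont'' /= scaler0.
  rewrite f1E g1E -polyCM redexp_modp ?coefC ?gtn_eqF //.
  by move=> [_|N]; rewrite ?redexp0 // coefC eqxx.
have lt : (size u0 < n)%N by rewrite -sz0.
(* Inserting g f = c between the factors: (a g)(f b) = c a b = 0. *)
have a1b : star i a1 (lift b) = 0 by rewrite (a1_lift _ _ _ bP) ab0 scaler0.
have [a10|lb0] := IH _ lt _ _ _ _ _ _ a1P (liftP _ _ _ bP) a1b.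
  have nP : {subset msupp (<< [::] >> : V) <= vspace j j 0}.
    exact: nil_vspace.
  (* The empty word at j is a right unit for [a], so a1 = 0 would give c a = 0. *)
  have := a1_lift _ _ _ nP; rewrite a10 (star_nil aP) {1}/star linear0.
  by move/esym/eqP; rewrite scaler_eq0 (negbTE c0) (negbTE a0).
have := b1_lift _ _ _ bP; rewrite lb0 linear0 => /esym/eqP.
by rewrite scaler_eq0 (negbTE c0) (negbTE b0).
Qed.

End NormalForm.

(** * The quotient of the path algebra *)

Section CoxeterAlgebra.
Variables (F : fieldType) (C : nat -> {poly F}).
Hypothesis C_irr :
  forall m, (3 <= m)%N -> irreducible_poly (C m) /\ ~~ root (C m) 0.
Variables (I : choiceType) (M : coxeter_matrix I).

Local Notation edge := (cox_edge M).
Local Notation P := {malg F[cox_path M]}.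
Local Notation V := {malg F[seq (syllable I)]}.
Local Notation walk := (walk F M).
Implicit Types (i j k : I) (f g : P) (x y : cox_path M).

Definition cox_modulus i j : {poly F} := if M i j is Some m then C m else 0.
Local Notation D := cox_modulus.

Lemma cox_edge_irr : irreflexive edge.
Proof. by move=> i; rewrite /cox_edge /= eqxx. Qed.

Lemma cox_edge_sym : symmetric edge.
Proof. by move=> i j; rewrite /cox_edge /= eq_sym cox_sym. Qed.

Lemma cox_modulus_sym i j : D i j = D j i.
Proof. by rewrite /cox_modulus cox_sym. Qed.

Lemma cox_modulus_good i j : edge i j -> good_modulus (D i j).
Proof.
rewrite /cox_modulus /cox_edge /= => /andP[_]; case: (M i j) => [m|] m3;
  last by left.
by right; apply: C_irr.
Qed.

Let cox_act_support := @act_support F I edge D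
  cox_edge_irr cox_edge_sym cox_modulus_sym cox_modulus_good.
Let cox_star_act := @star_act F I edge D
  cox_edge_irr cox_edge_sym cox_modulus_sym cox_modulus_good.
Let cox_star_domain := @star_domain F I edge D
  cox_edge_irr cox_edge_sym cox_modulus_sym cox_modulus_good.
Let cox_act_alt_mod := @act_alt_mod F I edge D
  cox_edge_irr cox_edge_sym cox_modulus_sym cox_modulus_good.

(** * Products of walks *)

Lemma walk_path i s (h : path edge i s) : walk i s = << Sub (i, s) h >>.
Proof. by rewrite /Defs.walk insubT. Qed.

Lemma walk_not_path i s : ~~ path edge i s -> walk i s = 0.
Proof. by move=> h; rewrite /Defs.walk insubF //; apply/negbTE. Qed.

Lemma walk_val x : walk (val x).1 (val x).2 = << x >>.
Proof.
rewrite (walk_path (valP x)); congr << _ >>; apply: val_inj.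
by rewrite SubK; case: (val x).
Qed.

Lemma pa_mulE f g : pa_mul f g = lext (fun x => lext (pa_cat F x) g) f.
Proof.
apply: eq_bigr => x _; rewrite scaler_sumr; apply: eq_bigr => y _.
by rewrite scalerA.
Qed.

Fact pa_mul_is_linear f : linear (pa_mul f).
Proof.
move=> c g h; rewrite !pa_mulE -lextZ -lextD; apply: eq_lext => x _.
by rewrite linearP.
Qed.

HB.instance Definition _ f :=
  GRing.isLinear.Build F P P *:%R (pa_mul f) (pa_mul_is_linear f).

Lemma pa_mul_lext (K : choiceType) (h : K -> P) a g :
  pa_mul (lext h a) g = lext (fun z => pa_mul (h z) g) a.
Proof.
by rewrite pa_mulE lext_comp; apply: eq_lext => z _; rewrite pa_mulE.
Qed.

Lemma pa_mul_pext (h : nat -> P) p g :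
  pa_mul (pext h p) g = pext (fun n => pa_mul (h n) g) p.
Proof.
by rewrite pa_mulE pext_comp; apply: eq_pext => z _; rewrite pa_mulE.
Qed.

Lemma pa_mulUU x y : pa_mul (<< x >> : P) << y >> = pa_cat F x y.
Proof. by rewrite pa_mulE !lextU. Qed.

Lemma pa_mul_walk i s j t :
  pa_mul (walk i s) (walk j t) = if last i s == j then walk i (s ++ t) else 0.
Proof.
case: (boolP (path edge i s)) => hs; last first.
  rewrite (walk_not_path hs) pa_mulE linear0 walk_not_path ?if_same //.
  by rewrite cat_path (negbTE hs).
case: (boolP (path edge j t)) => ht; last first.
  rewrite (walk_not_path ht) linear0; case: eqP => // E.
  by rewrite walk_not_path // cat_path E (negbTE ht) andbF.
by rewrite (walk_path hs) (walk_path ht) pa_mulUU.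
Qed.

Lemma pa_mul_walk_last i s t :
  pa_mul (walk i s) (walk (last i s) t) = walk i (s ++ t).
Proof. by rewrite pa_mul_walk eqxx. Qed.

(** The n-th power of y_ij y_ji is the alternating path of 2n steps, so the relation corresponds to
    C_m(X^2). *)
Lemma cox_relE i j m :
  cox_rel C M i j m = pext (fun n => walk i (alt i j (n * 2))) (C m).
Proof.
apply: eq_bigr => n _; congr (_ *: _).
rewrite (pa_mul_walk_last i [:: j]) /=; elim: (nat_of_ord n) => //= {}n ->.
exact: (pa_mul_walk_last i [:: j; i]).
Qed.

(** * The representation on reduced words *)

(** Paths with other ends are sent to 0, since a path is meant to act on words that start where it
    stops. As f is arbitrary, membership in a two-sided ideal can be tested on it. *)
Definition rep i j f (v : V) : V :=
  lext (fun x => if ((val x).1 == i) && (last (val x).1 (val x).2 == j)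
                 then act D i (val x).2 v else 0) f.

Lemma repU i j x v : rep i j << x >> v =
  if ((val x).1 == i) && (last (val x).1 (val x).2 == j)
  then act D i (val x).2 v else 0.
Proof. by rewrite /rep lextU. Qed.

Lemma rep_lext (K : choiceType) i j (h : K -> P) a v :
  rep i j (lext h a) v = lext (fun z => rep i j (h z) v) a.
Proof. by rewrite /rep lext_comp. Qed.

Lemma rep_pext i j (h : nat -> P) p v :
  rep i j (pext h p) v = pext (fun n => rep i j (h n) v) p.
Proof. by rewrite /rep pext_comp. Qed.

Lemma rep_walk i j i' s v : rep i j (walk i' s) v =
  if [&& path edge i' s, i' == i & last i' s == j] then act D i s v else 0.
Proof.
case: (boolP (path edge i' s)) => hs; first by rewrite (walk_path hs) repU.
by rewrite walk_not_path // /rep linear0.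
Qed.

Lemma rep_cat i j x y v : rep i j (pa_cat F x y) v =
  if [&& (val x).1 == i, last (val x).1 (val x).2 == (val y).1 &
         last (val y).1 (val y).2 == j]
  then act D i (val x).2 (act D (val y).1 (val y).2 v) else 0.
Proof.
rewrite /pa_cat; case: ifP => [/eqP E|_]; last by rewrite andbF /rep linear0.
rewrite rep_walk cat_path (valP x) E (valP y) last_cat E /=.
by case: eqP => //= <-; case: ifP => // _; rewrite act_cat E.
Qed.

Lemma rep_mull i j f g v : rep i j (pa_mul f g) v =
  lext (fun x => if (val x).1 == i
    then act D i (val x).2 (rep (last (val x).1 (val x).2) j g v) else 0) f.
Proof.
rewrite pa_mulE rep_lext; apply: eq_lext => x _; rewrite rep_lext.
under eq_lext => y _ do rewrite rep_cat.
case: ifP => _; last exact: lext0.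
rewrite /rep lext_comp; apply: eq_lext => y _ /=.
by rewrite eq_sym; case: ifP => [/andP[/eqP -> _]|_]; rewrite ?linear0.
Qed.

Lemma rep_mulr i j f g v : rep i j (pa_mul f g) v =
  lext (fun y => if last (val y).1 (val y).2 == j
    then rep i (val y).1 f (act D (val y).1 (val y).2 v) else 0) g.
Proof.
rewrite pa_mulE rep_lext; under eq_lext => x _ do rewrite rep_lext.
rewrite lext_exchange; apply: eq_lext => y _.
under eq_lext => x _ do rewrite rep_cat.
case: ifP => _; first by apply: eq_lext => x _; rewrite andbT.
by rewrite -[RHS](lext0 _ f); apply: eq_lext => x _; rewrite !andbF.
Qed.

(** This is a two-sided ideal that contains the relations, hence all of [cox_ideal]: the
    representation descends to the quotient. *)
Definition rep_null f := forall i j k n (v : V),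
  {subset msupp v <= vspace edge D j k n} -> rep i j f v = 0.

Lemma rep_nullP : two_sided_ideal rep_null.
Proof.
split=> [|f g hf hg|c f hf|f g hg|f g hf] i j k n v vP.
- by rewrite /rep linear0.
- rewrite /rep linearB /= -/(rep i j f v) -/(rep i j g v).
  by rewrite (hf _ _ _ _ _ vP) (hg _ _ _ _ _ vP) subr0.
- by rewrite /rep linearZ /= -/(rep i j f v) (hf _ _ _ _ _ vP) scaler0.
- rewrite rep_mull -[RHS](lext0 _ f); apply: eq_lext => x _.
  by rewrite (hg _ _ _ _ _ vP) linear0 if_same.
- rewrite rep_mulr -[RHS](lext0 _ g); apply: eq_lext => y _.
  case: eqP => // E; rewrite (hf _ _ k (size (val y).2 + n)%N) //.
  apply: cox_act_support.
    exact: valP y.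
  by rewrite E.
Qed.

Lemma alt_path p q n : edge p q -> path edge p (alt p q n).
Proof. by elim: n p q => //= n IH p q e; rewrite e IH // cox_edge_sym. Qed.

Lemma cox_edge_fin i j m : M i j = Some m -> (3 <= m)%N -> edge i j.
Proof.
move=> E m3; rewrite /cox_edge /= E m3 andbT; apply/eqP => ij.
by move: E m3; rewrite ij cox_diag => -[<-].
Qed.

(** Along its edge the relation acts as C_m(X^2), which is 0 modulo [Dz]. *)
Lemma rep_null_rel i j m : M i j = Some m -> (3 <= m)%N ->
  rep_null (cox_rel C M i j m).
Proof.
move=> E m3 i' j' k n v vP; have e := cox_edge_fin E m3.
rewrite cox_relE rep_pext.
transitivity (pext (fun n => if (i == i') && (i == j') then
    act D i (alt i j (n * 2)) v else 0) (C m)).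
  apply: eq_pext => N _; rewrite rep_walk alt_path // last_alt.
  by rewrite /altend oddM andbF /=; case: eqP => // ->.
have [/andP[_ /eqP Ej]|_] := boolP ((i == i') && (i == j')); last first.
  by apply: big1 => N _; rewrite scaler0.
rewrite -(pext_compX2 (fun N => act D i (alt i j N) v)).
have DE : C m = D i j by rewrite /cox_modulus E.
have par : parity_poly false (C m \Po 'X^2).
  by have := @comp_polyX2_parity _ (C m) false; rewrite expr0 mulr1.
rewrite (cox_act_alt_mod e par).
  by rewrite DE modpp linear0.
by move=> s /vP /and3P[]; rewrite Ej.
Qed.

Lemma cox_ideal_rep_null f : cox_ideal C f -> rep_null f.
Proof. by move=> hf; apply: (hf _ rep_nullP) => i j m; apply: rep_null_rel. Qed.


(** * Reduction of paths to normal form *)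

Let idC := cox_ideal_ideal C M.

Lemma cox_idealD f g : cox_ideal C f -> cox_ideal C g -> cox_ideal C (f + g).
Proof.
move=> hf hg; rewrite -[g]opprK; apply: (idealB idC) => //.
by rewrite -scaleN1r; apply: (idealZ idC).
Qed.

Lemma cox_ideal_lext (K : choiceType) (h : K -> P) a :
  (forall z, z \in msupp a -> cox_ideal C (h z)) -> cox_ideal C (lext h a).
Proof.
move=> hC; rewrite /lext big_seq; elim/big_rec: _ => [|z f /hC hz hf].
  exact: ideal0 idC.
by apply: cox_idealD => //; apply: (idealZ idC).
Qed.

(** The two polynomials differ by a multiple of [Dz]. It is 0 for the label infinity; for a finite m
    it is C_m(X^2) q, whose paths form the product of the relation with those of q followed by t. *)
Lemma cox_ideal_alt i j t (p : {poly F}) : edge i j ->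
  cox_ideal C (pext (fun n => walk i (alt i j n ++ t)) p
    - pext (fun n => walk i (alt i j n ++ t)) (p %% Dz D i j)).
Proof.
move=> e; rewrite -linearB /= {1}(divp_eq p (Dz D i j)) addrK mulrC.
move: (_ %/ _) => q; rewrite /Dz /cox_modulus.
case E: (M i j) => [m|]; last first.
  by rewrite comp_poly0 mul0r linear0; apply: ideal0 idC.
have m3 : (3 <= m)%N by move: e; rewrite /cox_edge /= E => /andP[].
rewrite pextM pext_compX2.
suff -> : pext (fun n =>
      pext (fun l => walk i (alt i j (n * 2 + l) ++ t)) q) (C m)
    = pa_mul (cox_rel C M i j m) (pext (fun l => walk i (alt i j l ++ t)) q).
  have rel_mem : cox_ideal C (cox_rel C M i j m) by move=> J _; apply.
  exact: idealMr idC _ _ rel_mem.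
rewrite cox_relE pa_mul_pext; apply: eq_pext => n _; rewrite pext_comp.
have a1 : altend i j (n * 2) = i by rewrite /altend oddM andbF.
have a2 : altend j i (n * 2) = j by rewrite /altend oddM andbF.
apply: eq_pext => k _ /=; rewrite alt_add a1 a2 -catA -pa_mul_walk_last.
by rewrite last_alt a1.
Qed.

Definition unrep i (v : V) : P := lext (fun s => walk i (vlist s)) v.

(** Reduced words span the quotient: by induction the path after its first edge is replaced by its
    normal form, and the first edge then costs one reduction modulo [Dz]. *)
Lemma cox_ideal_normal i s : path edge i s ->
  cox_ideal C (walk i s - unrep i (act D i s << [::] >>)).
Proof.
elim: s i => [|j s IH] i /=.
  by move=> _; rewrite /unrep lextU subrr; apply: ideal0 idC.
case/andP => e ps; set v := act D j s _.
have vP : {subset msupp v <= vspace edge D j (last j s) (size s + 0)}.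
  apply: cox_act_support => //.
  exact: nil_vspace.
rewrite -(subrK (pa_mul (walk i [:: j]) (unrep j v)) (walk i _)) -addrA.
apply: cox_idealD.
  rewrite -(pa_mul_walk_last i [:: j] s) -linearB.
  by apply: (idealMl idC); apply: IH.
rewrite /unrep lext_comp [X in _ - X]lext_comp -lextB.
apply: cox_ideal_lext => u /vP /and3P[vu _ _].
rewrite /= (pa_mul_walk_last i [:: j]) /=.
have e' : edge j i by rewrite cox_edge_sym.
have [Eu _ _ _ _] := vfrom_split cox_edge_irr cox_modulus_good e' vu.
rewrite /step hexpC htlC; move: (hexp j i u) (htl j i u) Eu => n w ->.
rewrite /epoly pext_comp vlist_ecat.
have -> : walk i (j :: alt j i n ++ vlist w)
    = pext (fun l => walk i (alt i j l ++ vlist w)) 'X^(n.+1) by rewrite pextXn.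
have := cox_ideal_alt (vlist w) 'X^(n.+1) e.
congr (cox_ideal C (_ - _)); apply: eq_pext => l _ /=.
by rewrite lextU vlist_ecat.
Qed.

Lemma pa_mul_corner i j f :
  pa_mul (pa_mul (walk i [::]) f) (walk j [::]) =
  lext (fun x => if ((val x).1 == i) && (last (val x).1 (val x).2 == j)
                 then << x >> else 0) f.
Proof.
rewrite -[f in LHS]lext_id lext_comp pa_mul_lext; apply: eq_lext => x _ /=.
rewrite -walk_val pa_mul_walk /= eq_sym; case: eqP => [E|_] /=; last first.
  by rewrite pa_mulE linear0.
by rewrite -E pa_mul_walk cats0.
Qed.

(** * Corners of the quotient algebra *)

Section Corner.
Variables (i j : I) (f : P).
Hypothesis f_corner : forall x, x \in msupp f ->
  (val x).1 = i /\ last (val x).1 (val x).2 = j.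

Lemma rep_corner v : rep i j f v = lext (fun x => act D i (val x).2 v) f.
Proof.
by apply: eq_lext => x /f_corner[-> ->]; rewrite !eqxx.
Qed.

Lemma rep_corner_vspace k n v : {subset msupp v <= vspace edge D j k n} ->
  exists n', {subset msupp (rep i j f v) <= vspace edge D i k n'}.
Proof.
move=> vP; exists (\max_(x <- msupp f) size (val x).2 + n)%N.
rewrite rep_corner; apply: lext_support => x xf s.
have [Ei Ej] := f_corner xf.
have := cox_act_support (valP x).
rewrite Ei in Ej *; rewrite Ej => /(_ _ _ _ vP s) h /h /and3P[vs ms ls].
apply/and3P; split=> //; apply: leq_trans ls _.
by rewrite leq_add2r (big_rem x) //= leq_maxl.
Qed.

(** Faithfulness: f is recovered modulo the ideal from its value on the empty word, and so lies in
    the ideal once this value is 0. *)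
Lemma cox_ideal_corner :
  cox_ideal C (f - unrep i (rep i j f << [::] >>)).
Proof.
rewrite rep_corner /unrep [X in _ - X]lext_comp -[X in X - _]lext_id -lextB.
apply: cox_ideal_lext => x /f_corner[Ei _] /=.
rewrite -walk_val Ei; apply: cox_ideal_normal.
by rewrite -Ei; apply: valP x.
Qed.

End Corner.

Lemma ca_cornerP i j (z : cox_alg C M) : ca_corner i j z ->
  exists2 f, z = ca_proj C f & forall x, x \in msupp f ->
    (val x).1 = i /\ last (val x).1 (val x).2 = j.
Proof.
case=> z' ->; pose f := repr z'.
exists (pa_mul (pa_mul (walk i [::]) f) (walk j [::])).
  by rewrite !ca_projM /ca_vertex /ca_proj reprK.
move=> x; rewrite pa_mul_corner => xf.
pose Q y := ((val y).1 == i) && (last (val y).1 (val y).2 == j).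
pose h y : P := if Q y then << y >> else 0.
suff /(_ x xf) /andP[/eqP ? /eqP ?] : {subset msupp (lext h f) <= Q} by [].
apply: lext_support => y _ y'; rewrite /h.
case: ifP => [Qy|_]; last by rewrite msupp0.
by move/(fsubsetP msuppU_le); rewrite in_fset1 => /eqP ->.
Qed.

Lemma ca_proj0 f : ca_proj C f = 0 <-> cox_ideal C f.
Proof.
have E : (0 : cox_alg C M) = ca_proj C 0.
  by rewrite /ca_proj raddf0.
by rewrite E ca_projP subr0.
Qed.

(** Lift the factors to f and g. On the empty word, f g takes as value the [star] product of the
    values of f and g; it is 0 as f g lies in the ideal. So one of the two values is 0, and that
    factor vanishes in the quotient. *)
Theorem cox_alg_domain i j k (x1 x2 : cox_alg C M) :
  ca_corner i j x1 -> ca_corner j k x2 -> ca_mul x1 x2 = 0 ->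
  x1 = 0 \/ x2 = 0.
Proof.
case/ca_cornerP => f -> fP /ca_cornerP[g -> gP].
rewrite -ca_projM ca_proj0 => /cox_ideal_rep_null.
move=> /(_ i k _ _ _ (@nil_vspace _ _ edge D k)).
have [n bP] := rep_corner_vspace gP (@nil_vspace _ _ edge D k).
have [n' aP] := rep_corner_vspace fP (@nil_vspace _ _ edge D j).
set a := rep i j f _ in aP; set b := rep j k g _ in bP => fg0.
have ab0 : star D i a b = 0.
  rewrite -fg0 rep_mull /a rep_corner // star_lext; apply: eq_lext => x xf.
  have [Ei Ej] := fP x xf; rewrite Ei eqxx; rewrite Ei in Ej.
  have xP : path edge i (val x).2 by rewrite -Ei; apply: valP x.
  have nP : {subset msupp (<< [::] >> : V)
      <= vspace edge D (last i (val x).2) j 0}.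
    by rewrite Ej; apply: nil_vspace.
  rewrite (cox_star_act xP nP bP).
  by rewrite starU Ej.
have [a0|b0] := cox_star_domain aP bP ab0.
  left; apply/ca_proj0; have := cox_ideal_corner fP.
  by rewrite -/a a0 /unrep linear0 subr0.
right; apply/ca_proj0; have := cox_ideal_corner gP.
by rewrite -/b b0 /unrep linear0 subr0.
Qed.

End CoxeterAlgebra.

(** * Irreducibility of the minimal polynomials *)

(** In a factorization of p one factor has the root x; by minimality it is at least as large as p,
    so the other is constant. *)
Lemma min_poly_irreducible (F : numFieldType) (x : F) (p : {poly rat}) :
  is_min_poly x p -> irreducible_poly p.
Proof.
case=> mon rx minp; have p0 := monic_neq0 mon.
have size_fac q r : p = r * q -> root (map_poly ratr r) x -> (size q <= 1)%N.
  move=> E rr.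
  have r0 : r != 0 by apply: contraNneq p0 => r0; rewrite E r0 mul0r.
  have q0 : q != 0 by apply: contraNneq p0 => q0; rewrite E q0 mulr0.
  have := minp _ r0 rr; rewrite E size_mul //; move: r0; rewrite -size_poly_gt0.
  by case: (size r) => // a _; case: (size q) => [|[|b]] //=; lia.
split=> [|q qs /dvdpP[r E]].
  rewrite ltnNge; apply/negP => /size1_polyC E.
  move: rx p0; rewrite E map_polyC rootC /= fmorph_eq0 => /eqP ->.
  by rewrite polyC0 eqxx.
have : root (map_poly ratr r * map_poly ratr q) x by rewrite -rmorphM -E.
rewrite rootM => /orP[/(size_fac _ _ E)|].
  have q0 : q != 0 by apply: contraNneq p0 => q0; rewrite E q0 mulr0.
  move: q0 qs; rewrite -size_poly_gt0.
  by case: (size q) => [|[]].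
rewrite mulrC in E; move=> /(size_fac _ _ E) r1.
have r0 : r != 0 by apply: contraNneq p0 => r0; rewrite E r0 mulr0.
rewrite E eqp_sym (size1_polyC r1) mulrC mul_polyC eqp_scale //.
by apply: contraNneq r0 => r0; rewrite (size1_polyC r1) r0 polyC0.
Qed.

(** If C_m(0) = 0, then X divides the irreducible C_m, so both are associates and 4 cos^2(PI / m) =
    0. But PI / m lies strictly between 0 and PI / 2. *)
Lemma coxC_irreducible m : (3 <= m)%N ->
  irreducible_poly (coxC m) /\ ~~ root (coxC m) 0.
Proof.
move=> m3; have m0 : (0 < m)%N by apply: leq_trans m3.
have mp := coxCP m0; have irr := min_poly_irreducible mp; split=> //.
apply/negP => r0; case: mp => _ rx _.
set x := 4 * _ in rx.
have : 'X %| coxC m by rewrite -['X]subr0 -polyC0 dvdp_XsubCl.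
move=> /(irr.2 _); rewrite size_polyX => /(_ isT).
move=> /eqpP[[u v] /= /andP[u0 v0] E].
have : x = 0.
  move: rx; rewrite -(rootZ _ _ (_ : ratr v != 0)) ?fmorph_eq0 // -map_polyZ -E.
  rewrite map_polyZ map_polyX rootZ ?fmorph_eq0 // => /rootP.
  by rewrite hornerX.
apply/eqP; rewrite mulf_neq0 ?expf_neq0 ?pnatr_eq0 //.
have pi0 : 0 < PI by apply/RltP; apply: PI_RGT_0.
have mR : 2 < m%:R :> Rdefinitions.R by rewrite (ltr_nat _ 2).
have x0 : 0 < PI / m%:R by rewrite divr_gt0 // (lt_trans _ mR).
have : 0 < cos (PI / m%:R).
  apply/RltP/cos_gt_0; apply/RltP; rewrite RdivE IZRposE INRE.
    by rewrite RoppE (lt_trans _ x0) //= oppr_lt0 divr_gt0 // ltr0n.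
  by rewrite ltr_pM2l // ltf_pV2 ?posrE ?ltr0n.
by move/gt_eqF => ->.
Qed.

Theorem theorem8p2 (I : choiceType) (M : coxeter_matrix I) (i j k : I)
    (x1 x2 : cox_alg coxC M) (hx1 : ca_corner i j x1) (hx2 : ca_corner j k x2)
    (hx12 : ca_mul x1 x2 = 0) :
  x1 = 0 \/ x2 = 0.
Proof. exact (cox_alg_domain coxC_irreducible hx1 hx2 hx12). Qed.
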